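(* Let $b\ge 2$ be an integer, $s\in\mathbb{N}$, and let $\mathcal{K}:[0,1]^s\times[0,1]^s\to\mathbb{R}$ be the reproducing kernel of a reproducing kernel Hilbert space $\mathcal{H}$ of functions on $[0,1]^s$, with $\int_{[0,1]^s}\sqrt{\mathcal{K}(\boldsymbol{x},\boldsymbol{x})}\,\mathrm{d}\boldsymbol{x}<\infty$. Let $\mathcal{K}_{\mathrm{sh},\phi_b}$ be its folded digitally shifted reproducing kernel, and suppose $\mathcal{K},\mathcal{K}_{\mathrm{sh},\phi_b}\in L_2([0,1]^{2s})$. Suppose that the Walsh series expansion of $\mathcal{K}_{\mathrm{sh},\phi_b}$ converges to $\mathcal{K}_{\mathrm{sh},\phi_b}$ pointwise absolutely. Then for every point set $P_{N,s}\subset[0,1]^s$ of $N$ points, the mean square worst-case error of $\phi_b(P_{N,s}\oplus\boldsymbol{\sigma})$ (with respect to a uniformly random digital shift $\boldsymbol{\sigma}\in[0,1]^s$) is $$\hat e^2(P_{N,s},\mathcal{K})=\sum_{\boldsymbol{k}\in(\mathcal{E}_b\cup\{0\})^s\setminus\{\boldsymbol{0}\}}\hat{\mathcal{K}}(\lfloor\boldsymbol{k}/b\rfloor,\lfloor\boldsymbol{k}/b\rfloor)\,\frac{1}{N^2}\sum_{\boldsymbol{x},\boldsymbol{y}\in P_{N,s}}\mathrm{wal}_{\boldsymbol{k}}(\boldsymbol{x})\overline{\mathrm{wal}_{\boldsymbol{k}}(\boldsymbol{y})},$$ where $\boldsymbol{0}$ is the vector of $s$ zeros. In particular, when $P_{b^m,s}$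 is a digital net over $\mathbb{Z}_b$ with $N=b^m$ points, $$\hat e^2(P_{b^m,s},\mathcal{K})=\sum_{\substack{\boldsymbol{k}\in(\mathcal{E}_b\cup\{0\})^s\setminus\{\boldsymbol{0}\}\\ \boldsymbol{k}\in D^{\perp}(P_{b^m,s})}}\hat{\mathcal{K}}(\lfloor\boldsymbol{k}/b\rfloor,\lfloor\boldsymbol{k}/b\rfloor),$$ where $D^{\perp}(P_{b^m,s})$ is the dual net of $P_{b^m,s}$.
   Context: Notation. $\mathbb{N}$ is the set of positive integers, $\mathbb{N}_0=\mathbb{N}\cup\{0\}$, and $\mathbb{Z}_b=\{0,\dots,b-1\}$ with arithmetic modulo $b$. $b$-adic expansions. Each $x\in[0,1]$ is given its unique expansion $x=\sum_{i\ge1}\xi_ib^{-i}$, $\xi_i\in\mathbb{Z}_b$, with infinitely many $\xi_i\ne b-1$ if $x\ne1$, and all $\xi_i=b-1$ if $x=1$. The operation $x\oplus x'$ is digitwise addition modulo $b$ of these expansions: $x\oplus x'=\sum_i\eta_ib^{-i}$ with $\eta_i=\xi_i+\xi_i' \pmod b$. It is applied componentwise to vectors. Walsh functions. For $k=\kappa_0+\kappa_1b+\dots+\kappa_{a-1}b^{a-1}\in\mathbb{N}_0$ ($\kappa_i\in\mathbb{Z}_b$) and $x=\sum_i\xi_ib^{-i}\in[0,1]$, $\mathrm{wal}_k(x)=\omega_b^{\kappa_0\xi_1+\dots+\kappa_{a-1}\xi_a}$ with $\omega_b=\exp(2\pi\sqrt{-1}/b)$. For vectors, $\mathrm{wal}_{\boldsymbol{k}}(\boldsymbol{x})=\prod_{j=1}^s\mathrm{wal}_{k_j}(x_j)$.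 $b$-adic tent transformation. For $x=\sum_i\xi_ib^{-i}\in[0,1]$, $\phi_b(x)=\sum_{i\ge1}\eta_ib^{-i}$ with $\eta_i\in\mathbb{Z}_b$, $\eta_i=\xi_{i+1}-\xi_1 \pmod b$. It is applied componentwise to vectors. Errors. $I(f)=\int_{[0,1]^s}f(\boldsymbol{x})\,\mathrm{d}\boldsymbol{x}$ and $Q(f;P_{N,s})=\frac1N\sum_{\boldsymbol{x}\in P_{N,s}}f(\boldsymbol{x})$. The square worst-case error is $e^2(P_{N,s},\mathcal{K})=\big(\sup_{f\in\mathcal{H},\|f\|_{\mathcal{H}}\le1}|I(f)-Q(f;P_{N,s})|\big)^2$. Set $\phi_b(P_{N,s}\oplus\boldsymbol{\sigma})=\{\phi_b(\boldsymbol{x}\oplus\boldsymbol{\sigma}):\boldsymbol{x}\in P_{N,s}\}$, points counted with multiplicity (so it consists of $N$ points). The mean square worst-case error is $\hat e^2(P_{N,s},\mathcal{K})=\int_{[0,1]^s}e^2(\phi_b(P_{N,s}\oplus\boldsymbol{\sigma}),\mathcal{K})\,\mathrm{d}\boldsymbol{\sigma}$. Folded digitally shifted kernel: $\mathcal{K}_{\mathrm{sh},\phi_b}(\boldsymbol{x},\boldsymbol{y})=\int_{[0,1]^s}\mathcal{K}(\phi_b(\boldsymbol{x}\oplus\boldsymbol{\sigma}),\phi_b(\boldsymbol{y}\oplus\boldsymbol{\sigma}))\,\mathrm{d}\boldsymbol{\sigma}$. Walsh coefficients of a function $F$ on $[0,1]^{2s}$ (for $F=\mathcal{K}$ or $\mathcal{K}_{\mathrm{sh},\phi_b}$):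 $\hat F(\boldsymbol{k},\boldsymbol{l})=\int_{[0,1]^{2s}}F(\boldsymbol{x},\boldsymbol{y})\overline{\mathrm{wal}_{\boldsymbol{k}}(\boldsymbol{x})}\mathrm{wal}_{\boldsymbol{l}}(\boldsymbol{y})\,\mathrm{d}\boldsymbol{x}\,\mathrm{d}\boldsymbol{y}$, and the Walsh series expansion is $\sum_{\boldsymbol{k},\boldsymbol{l}\in\mathbb{N}_0^s}\hat F(\boldsymbol{k},\boldsymbol{l})\mathrm{wal}_{\boldsymbol{k}}(\boldsymbol{x})\overline{\mathrm{wal}_{\boldsymbol{l}}(\boldsymbol{y})}$. Sum of digits. For $k=\kappa_0+\kappa_1b+\dots+\kappa_{a-1}b^{a-1}$, $\delta_b(k)=\kappa_0+\dots+\kappa_{a-1}$. $\mathcal{E}_b=\{k\in\mathbb{N}:\delta_b(k)\equiv0\pmod b\}$. $\lfloor\boldsymbol{k}/b\rfloor=(\lfloor k_1/b\rfloor,\dots,\lfloor k_s/b\rfloor)$. Digital nets. For $m,n\in\mathbb{N}$ with $m\le n$, let $P_{b^m,s}\subset[0,1]^s$ consist of $b^m$ points all of whose coordinates have the form $x_j=\xi_{1,j}b^{-1}+\dots+\xi_{n,j}b^{-n}$ with $\xi_{i,j}\in\mathbb{Z}_b$ ($n$-digit precision). Each point is thereby identified with an element of $\mathbb{Z}_b^{s\times n}$. $P_{b^m,s}$ is a digital net over $\mathbb{Z}_b$ if the corresponding subset of $\mathbb{Z}_b^{s\times n}$ is a subgroup under componentwise addition modulo $b$. Dual net. $D^{\perp}(P_{b^m,s})=\{\boldsymbol{k}\in\mathbb{N}_0^s:\vec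 k_1\cdot\vec x_1+\dots+\vec k_s\cdot\vec x_s=0\pmod b\text{ for all }\boldsymbol{x}\in P_{b^m,s}\}$, where for $k_j=\kappa_{0,j}+\kappa_{1,j}b+\cdots$ we put $\vec k_j=(\kappa_{0,j},\dots,\kappa_{n-1,j})^\top\in\mathbb{Z}_b^n$ and $\vec x_j=(\xi_{1,j},\dots,\xi_{n,j})^\top\in\mathbb{Z}_b^n$. *)

(* Defs.v *)
From HB Require Import structures.
From mathcomp Require Import all_boot all_order all_algebra.
From mathcomp Require Import finmap.
From mathcomp Require Import all_classical all_reals all_analysis.
From mathcomp Require Import complex.
From mathcomp.analysis.showcase Require summability.

Set Implicit Arguments.
Unset Strict Implicit.
Unset Printing Implicit Defensive.
Import Order.TTheory GRing.Theory Num.Theory numFieldNormedType.Exports.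

Local Open Scope classical_set_scope.
Local Open Scope ring_scope.

(* lebesgue_measure is a measure on measurableTypeR R, which is R with its Borel
   sigma-algebra; points of R^s are tuples over that type, with the product
   sigma-algebra. *)
Notation vecR R s := (s.-tuple (measurableTypeR R)).

Section lebesgue_tuple.
Context (R : realType).

Definition consp n (z : measurableTypeR R * vecR R n) : vecR R n.+1 :=
  [tuple of z.1 :: z.2].

Definition unconsp n (x : vecR R n.+1) : measurableTypeR R * vecR R n :=
  (thead x, [tuple of behead x]).

Lemma measurable_consp n : measurable_fun [set: _] (@consp n).
Proof. exact: measurable_cons. Qed.

Lemma measurable_unconsp n : measurable_fun [set: _] (@unconsp n).
Proof.
apply: measurable_fun_pair; first exact: measurable_tnth.
exact: measurable_behead.
Qed.

Lemma conspK n : cancel (@consp n) (@unconsp n).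
Proof.
by move=> [a b]; rewrite /unconsp /consp theadE; congr pair; exact: val_inj.
Qed.

Section step.
Context n (mu : {sigma_finite_measure set (vecR R n) -> \bar R}).

Definition lebn_step : set (vecR R n.+1) -> \bar R :=
  pushforward (lebesgue_measure \x mu)%E (@consp n).

HB.instance Definition _ := Measure.copy lebn_step
  (measure_function_pushforward__canonical__measure_function_Measure
    (lebesgue_measure \x mu)%E (@measurable_consp n)).

Lemma lebn_step_sigma_finite : sigma_finite [set: _] lebn_step.
Proof.
have /sigma_finiteP[F [TF ndF Foo]] :=
  @sigma_finiteT _ _ _ (@lebesgue_measure R).
have /sigma_finiteP[G [TG ndG Goo]] := sigma_finiteT mu.
exists (fun k => @unconsp n @^-1` (F k `*` G k)).
  rewrite -preimage_bigcup (_ : \bigcup_k _ = setT) ?preimage_setT//.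
  rewrite -setXTT TF TG predeqE => -[x y]; split.
    by move=> [k _ [/= ? ?]]; split; exists k.
  move=> [/= [k _ Fkx] [l _ Gly]]; exists (maxn k l) => //; split.
  - by move: x Fkx; exact/subsetPset/ndF/leq_maxl.
  - by move: y Gly; exact/subsetPset/ndG/leq_maxr.
move=> k; have [? ?] := Foo k; have [? ?] := Goo k.
have mFG : measurable (F k `*` G k) by exact: measurableX.
split; first by rewrite -[X in measurable X]setTI; exact: measurable_unconsp.
rewrite /lebn_step /pushforward -comp_preimage.
rewrite (_ : _ @^-1` _ = F k `*` G k).
  by rewrite product_measure1E// lte_mul_pinfty// ge0_fin_numE.
by apply/seteqP; split=> z; rewrite /preimage /mkset /comp conspK.
Qed.

HB.instance Definition _ := Measure_isSigmaFinite.Build _ _ _ lebn_step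
  lebn_step_sigma_finite.

End step.

(* Lebesgue measure on R^n *)
Fixpoint lebn n : {sigma_finite_measure set (vecR R n) -> \bar R} :=
  match n with
  | 0 => \d_([tuple] : vecR R 0)
  | n'.+1 => lebn_step (lebn n')
  end.

End lebesgue_tuple.

Lemma lebn_box (R : realType) s (A : nat -> set (measurableTypeR R)) :
  (forall i, measurable (A i)) ->
  lebn R s [set x | forall j : 'I_s, A j (tnth x j)] =
  (\prod_(i < s) lebesgue_measure (A i))%E.
Proof.
elim: s A => [|s IH] A mA.
  rewrite big_ord0 /= diracE mem_set//=; by case.
rewrite big_ord_recl -(IH (fun i => A i.+1))//= -product_measure1E//.
  rewrite /lebn_step /pushforward; congr (_ _).
  apply/seteqP; split=> -[a b]/=.
    move=> h; split; first exact: (h ord0).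
    move=> j; have := h (lift ord0 j); by rewrite /consp tnthS.
  move=> [h1 h2] j; case: (unliftP ord0 j) => [i|] ->//; by rewrite /consp tnthS; exact: h2.
have -> : [set x : vecR R s | forall j : 'I_s, A j.+1 (tnth x j)] =
    \bigcap_(j in [set: 'I_s]) ((@tnth _ _ ^~ j) @^-1` (A j.+1)).
  by apply/seteqP; split=> x /= h => [j _|j]; apply: h.
apply: fin_bigcap_measurable => //.
by move=> j _; rewrite -[X in measurable X]setTI; apply: measurable_tnth.
Qed.

Section badic.
Context (R : realType) (b : nat).

(* The digit xi_(i+1) of the usual numbering is xi i here.  All statements
   assume 1 < b, so that 'Z_b is {0, ..., b-1} with arithmetic modulo b. *)
Definition badic_sum (xi : nat -> 'Z_b) : R^nat :=
  series (fun i => (xi i : nat)%:R / b%:R ^+ i.+1).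

Definition badic_value (xi : nat -> 'Z_b) : R := limn (badic_sum xi).

Definition badic_expansion (x : R) (xi : nat -> 'Z_b) : Prop :=
  badic_sum xi @ \oo --> x /\
  (if x == 1 then forall i, xi i = b.-1 :> nat
   else forall n, exists2 i, (n <= i)%N & xi i <> b.-1 :> nat).

(* For 1 < b and x in [0, 1] there is exactly one badic_expansion of x; the
   default value 0 is only reached outside of [0, 1]. *)
Definition digits (x : R) : nat -> 'Z_b :=
  xget (fun=> 0) [set xi | badic_expansion x xi].

Definition oplus (x y : R) : R :=
  badic_value (fun i => digits x i + digits y i).

Definition tent (x : R) : R :=
  badic_value (fun i => digits x i.+1 - digits x 0).

Definition vec_oplus s (x y : vecR R s) : vecR R s :=
  [tuple oplus (tnth x j) (tnth y j) | j < s].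

Definition vec_tent s (x : vecR R s) : vecR R s :=
  [tuple tent (tnth x j) | j < s].

Definition nat_digit (k i : nat) : nat := ((k %/ b ^ i) %% b)%N.

Definition omega : R[i] :=
  (cos (2 * pi / b%:R) +i* sin (2 * pi / b%:R))%C.

(* For 1 < b, k < b ^ k, so that all nonzero digits of k have index < k. *)
Definition wal (k : nat) (x : R) : R[i] :=
  omega ^+ (\sum_(i < k) nat_digit k i * digits x i)%N.

Definition vec_wal s (k : s.-tuple nat) (x : vecR R s) : R[i] :=
  \prod_(j < s) wal (tnth k j) (tnth x j).

Definition sum_of_digits (k : nat) : nat := (\sum_(i < k) nat_digit k i)%N.

Definition Eb : set nat := [set k | (0 < k)%N /\ (b %| sum_of_digits k)%N].

Definition vec_floor s (k : s.-tuple nat) : s.-tuple nat :=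
  [tuple (tnth k j %/ b)%N | j < s].

Definition index_set s : set (s.-tuple nat) :=
  [set k | forall j, (Eb `|` [set 0%N]) (tnth k j)] `\ [tuple 0%N | j < s].

End badic.
Arguments index_set : clear implicits.

Section integration.
Context (R : realType) (s : nat).

Definition cube : set (vecR R s) :=
  [set x | forall j, (tnth x j : R) \in `[0, 1]].

Definition leb2 : {measure set (vecR R s * vecR R s)%type -> \bar R} :=
  (lebn R s \x lebn R s)%E.

Definition square_integrable (F : vecR R s -> vecR R s -> R) : Prop :=
  (fun z => F z.1 z.2) \_ (cube `*` cube) \in Lfun leb2 2%:E.

Definition Cintegral d (T : measurableType d)
    (mu : {measure set T -> \bar R}) (D : set T) (f : T -> R[i]) : R[i] :=
  ((\int[mu]_(x in D) complex.Re (f x)) +i*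
   (\int[mu]_(x in D) complex.Im (f x)))%C.

Definition walsh_coef b (F : vecR R s -> vecR R s -> R)
    (k l : s.-tuple nat) : R[i] :=
  Cintegral leb2 (cube `*` cube)
    (fun z => (F z.1 z.2)%:C%C * (vec_wal b k z.1)^* * vec_wal b l z.2).

(* Extended real valued: the finiteness of the value at (x, y) is the
   existence of the integral. *)
Definition shifted_kernel b (K : vecR R s -> vecR R s -> R)
    (x y : vecR R s) : \bar R :=
  (\int[lebn R s]_(sigma in cube)
    (K (vec_tent b (vec_oplus b x sigma))
       (vec_tent b (vec_oplus b y sigma)))%:E)%E.

End integration.
Arguments cube : clear implicits.

(* The family f restricted to A is absolutely summable, with finite sum v. *)
Definition sums_to (R : realType) (I : choiceType) (A : set I) (f : I -> R[i])
    (v : \bar R) : Prop :=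
  exists r : R, [/\ v = r%:E,
    (\esum_(i in A) (complex.Re `|f i|)%:E < +oo)%E &
    (fun F : {fset I} => \sum_(i <- F | i \in A) f i)
      @ summability.totally --> (r%:C%C : R[i]^o)].

(* Hilbert spaces of real functions on D: feval f is the function represented
   by f, of which only the values on D matter.  The norm is the one induced by
   the inner product, and completeness is part of completeNormedModType. *)
Record hilbert_fun_space (R : realType) (T : Type) (D : set T) := {
  hspace :> completeNormedModType R;
  feval : hspace -> T -> R;
  inner : hspace -> hspace -> R;
  feval_linear : forall a f g x, D x ->
    feval (a *: f + g) x = a * feval f x + feval g x;
  feval_inj : forall f g, (forall x, D x -> feval f x = feval g x) -> f = g;
  innerC : forall f g, inner f g = inner g f;
  inner_linear : forall a f g h, inner (a *: f + g) h = a * inner f h + inner g h;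
  inner_norm : forall f, inner f f = `|f| ^+ 2
}.

Definition is_reproducing_kernel (R : realType) (T : Type) (D : set T)
    (H : hilbert_fun_space R D) (K : T -> T -> R) : Prop :=
  forall y, D y -> exists Ky : H,
    (forall x, D x -> feval Ky x = K x y) /\ (forall f, inner f Ky = feval f y).

Section errors.
Context (R : realType) (s : nat) (H : hilbert_fun_space R (cube R s)).

Definition Ifun (f : H) : R := \int[lebn R s]_(x in cube R s) feval f x.

(* Point sets are N-tuples of points, counted with multiplicity. *)
Definition Qfun N (P : N.-tuple (vecR R s)) (f : H) : R :=
  N%:R^-1 * \sum_(x <- P) feval f x.

Definition sq_wce N (P : N.-tuple (vecR R s)) : \bar R :=
  (ereal_sup [set `|Ifun f - Qfun P f|%:E | f in [set f : H | (`|f| <= 1)%R]]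
    ^+ 2)%E.

Definition fold_shift b N (P : N.-tuple (vecR R s)) (sigma : vecR R s) :
    N.-tuple (vecR R s) :=
  [tuple vec_tent b (vec_oplus b (tnth P i) sigma) | i < N].

Definition mean_sq_wce b N (P : N.-tuple (vecR R s)) : \bar R :=
  (\int[lebn R s]_(sigma in cube R s) sq_wce (fold_shift b P sigma))%E.

End errors.

Section digital_nets.
Context (R : realType) (b s n : nat).

Definition net_point (M : 'M['Z_b]_(s, n)) : vecR R s :=
  [tuple \sum_(i < n) (M j i : nat)%:R / b%:R ^+ i.+1 | j < s].

(* uniq P: a digital net is a subset of [0, 1]^s with exactly b ^ m points. *)
Definition digital_net m (P : (b ^ m).-tuple (vecR R s)) : Prop :=
  [/\ uniq P,
      (forall x, x \in P -> exists M, x = net_point M) &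
      zmod_closed [set M | net_point M \in P]%SET].

Definition dual_net m (P : (b ^ m).-tuple (vecR R s)) : set (s.-tuple nat) :=
  [set k | forall x, x \in P ->
    (b %| \sum_(j < s) \sum_(i < n)
       nat_digit b (tnth k j) i * digits b (tnth x j : R) i)%N].

End digital_nets.

(* Main.v *)
Require Import Defs.
From HB Require Import structures.
From mathcomp Require Import all_boot all_order all_algebra.
From mathcomp Require Import finmap.
From mathcomp Require Import all_classical all_reals all_analysis.
From mathcomp Require Import complex measurable_realfun ring lra zify.
From mathcomp.analysis.showcase Require summability.

Set Implicit Arguments.
Unset Strict Implicit.
Unset Printing Implicit Defensive.
Import Order.TTheory GRing.Theory Num.Theory numFieldNormedType.Exports.

Local Open Scope classical_set_scope.
Local Open Scope ring_scope.

(** Idea of the proof.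

    In a reproducing kernel Hilbert space, integration over the cube is a
    bounded functional, because [|f x| <= |f| * sqrt (K x x)] and the right-hand
    side is integrable; by the Riesz theorem ([riesz]) it is represented by some
    [g], and [|g|^2] is the double integral of [K], that is, the Walsh
    coefficient of [K] at [(0, 0)] ([walsh_coef0E]).  The worst-case error of a
    point set is the norm of the representer of the error functional, so its
    square is [|g|^2 - 2/N sum_x g x + 1/N^2 sum_(x, y) K x y] ([sq_wceE]).
    Since [phi_b (x (+) sigma)] is uniformly distributed on the cube for each
    [x], averaging over [sigma] replaces the middle term by [- 2 |g|^2] and the
    last kernel by the folded shifted kernel ([mean_sq_wceE]).

    It remains to expand the folded shifted kernel.  Its Walsh coefficients are
    computed by changes of variables that preserve Lebesgue measure.  Fubini's
    theorem and the substitution [x -> x (+) sigma] give the coefficient of the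
    folded kernel [K (phi_b x, phi_b y)] times the integral over [sigma] of
    [wal_k sigma * conj (wal_l sigma)], which is [1] if [k = l] and [0] otherwise
    ([walsh_coef_shifted]).  Adding [1] to all digits of one coordinate of [x]
    does not change [phi_b x] and multiplies [wal_k x] by
    [omega ^ (sum of digits of k_j)], so the coefficient vanishes unless [b]
    divides every digit sum ([folded_coef0]); in that case
    [wal_k x = wal_(floor (k / b)) (phi_b x)] and the coefficient is that of [K]
    at [floor (k / b)] ([folded_coefE]).  The vanishing arguments all use that an
    integral multiplied by some [c <> 1] under a measure-preserving map is zero
    ([Cintegral_eq0]).  Summing the Walsh series over the pairs of points, the
    term [k = 0] equals [|g|^2] and cancels.  For a digital net the double sum is
    a character sum over a finite group, equal to [N^2] or [0] according to
    whether [k] lies in the dual net ([sum_wal_digital_net]).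

    All this rests on [x -> x (+) c] and [phi_b] preserving Lebesgue measure,
    which is checked on the cylinders prescribing the first [n] digits
    ([preserving_of_cylinders]).  Digitwise identities such as
    [digits (x (+) c) = digits x + digits c] fail only when the right-hand side
    ends in an infinite run of [b - 1], and this happens for countably many [x]
    ([countable_tail_set]). *)

(** * Expansions in base b *)

Section digits.
Context (R : realType) (b : nat) (hb : (1 < b)%N).
Implicit Types (xi : nat -> 'Z_b) (x : R).

Lemma ltn_Zb (a : 'Z_b) : (a < b)%N.
Proof. by have := ltn_ord a; rewrite [X in (_ < X)%N]Zp_cast. Qed.

Lemma val_inZp k : (inZp k : 'Z_b) = (k %% b)%N :> nat.
Proof. by rewrite /= Zp_cast. Qed.

Lemma val_addZp (a c : 'Z_b) : (a + c)%R = ((a + c) %% b)%N :> nat.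
Proof. by congr modn; rewrite Zp_cast. Qed.

Lemma b_gt0 : (0 : R) < b%:R. Proof. by rewrite ltr0n ltnW. Qed.
Lemma b_neq0 : (b%:R : R) != 0. Proof. by rewrite gt_eqF// b_gt0. Qed.
Lemma bX_gt0 n : (0 : R) < b%:R ^+ n. Proof. by rewrite exprn_gt0// b_gt0. Qed.
Lemma bX_neq0 n : (b%:R ^+ n : R) != 0. Proof. by rewrite gt_eqF// bX_gt0. Qed.

(** The integer whose base-[b] digits are the first [n] terms of [xi]. *)
Fixpoint prefix_num xi n : nat :=
  if n is n'.+1 then (b * prefix_num xi n' + xi n')%N else 0%N.

Lemma eq_prefix_num xi xi' n :
  (forall i, (i < n)%N -> xi i = xi' i) -> prefix_num xi n = prefix_num xi' n.
Proof.
elim: n => //= n IH h; rewrite h// IH// => i i_lt; apply: h; exact: ltnW.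
Qed.

Lemma prefix_num_inj xi xi' n : prefix_num xi n = prefix_num xi' n ->
  forall i, (i < n)%N -> xi i = xi' i.
Proof.
elim: n => //= n IH e i.
have eqb z k : (b * z + xi k = z * b + xi k)%N by rewrite mulnC.
have e1 : prefix_num xi n = prefix_num xi' n.
  have := congr1 (fun k => k %/ b)%N e; rewrite ![(b * _)%N]mulnC.
  by rewrite !divnMDl ?(ltnW hb)// !divn_small ?ltn_Zb// !addn0.
have e2 : xi n = xi' n by apply/val_inj/(@addnI (b * prefix_num xi n)%N); rewrite /= e e1.
rewrite ltnS leq_eqVlt => /orP[/eqP->//|]; exact: IH.
Qed.

Lemma prefix_num_lt xi n : (prefix_num xi n < b ^ n)%N.
Proof.
elim: n => //= n IH.
apply: (@leq_trans (b * (prefix_num xi n).+1)%N); last by rewrite expnS leq_mul2l IH orbT.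
by rewrite mulnS addnC ltn_add2r ltn_Zb.
Qed.

Lemma badic_sumE xi n : badic_sum R xi n = (prefix_num xi n)%:R / b%:R ^+ n.
Proof.
elim: n => [|n IH]; first by rewrite /badic_sum seriesEnat/= big_nil mul0r.
move: IH; rewrite /badic_sum !seriesEnat/= big_nat_recr//= => ->.
rewrite natrD natrM exprS; have := bX_neq0 n; have := b_neq0.
by move=> ? ?; field; apply/andP.
Qed.

Lemma badic_sum_nd xi : nondecreasing_seq (badic_sum R xi).
Proof.
by apply: nondecreasing_series => i _ _; rewrite divr_ge0// ?ler0n// ltW// bX_gt0.
Qed.

Lemma badic_sum_ub_noninc xi n m : (n <= m)%N ->
  (prefix_num xi m).+1%:R / b%:R ^+ m <= (prefix_num xi n).+1%:R / b%:R ^+ n :> R.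
Proof.
elim: m => [|m IH]; first by rewrite leqn0 => /eqP->.
rewrite leq_eqVlt => /orP[/eqP->//|]; rewrite ltnS => /IH; apply: le_trans => /=.
rewrite ler_pdivrMr ?bX_gt0// exprSr mulrA divfK ?bX_neq0//.
by rewrite -natrM ler_nat; have := ltn_Zb (xi m); nia.
Qed.

Lemma badic_sum_le xi n m :
  badic_sum R xi m <= (prefix_num xi n).+1%:R / b%:R ^+ n.
Proof.
apply: (@le_trans _ _ (badic_sum R xi (maxn n m))); first exact/badic_sum_nd/leq_maxr.
apply: le_trans (badic_sum_ub_noninc xi (leq_maxl n m)).
by rewrite badic_sumE ler_pM2r ?invr_gt0 ?bX_gt0// ler_nat.
Qed.

Lemma is_cvg_badic_sum xi : cvgn (badic_sum R xi).
Proof.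
apply: nondecreasing_is_cvgn; first exact: badic_sum_nd.
by exists ((prefix_num xi 0).+1%:R / b%:R ^+ 0) => _ [m _ <-]; exact: badic_sum_le.
Qed.

Lemma badic_sum_cvg xi : badic_sum R xi @ \oo --> badic_value R xi.
Proof. exact: is_cvg_badic_sum. Qed.

Lemma badic_value_ge xi n : (prefix_num xi n)%:R / b%:R ^+ n <= badic_value R xi.
Proof.
rewrite -badic_sumE; apply: nondecreasing_cvgn_le; first exact: badic_sum_nd.
exact: is_cvg_badic_sum.
Qed.

Lemma badic_value_le xi n : badic_value R xi <= (prefix_num xi n).+1%:R / b%:R ^+ n.
Proof.
apply: limr_le; first exact: is_cvg_badic_sum.
by apply: nearW => m; exact: badic_sum_le.
Qed.

Lemma badic_value01 xi : 0 <= badic_value R xi <= 1.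
Proof.
by have := badic_value_ge xi 0; have := badic_value_le xi 0; rewrite /= expr0 divr1 mul0r => -> ->.
Qed.

Lemma badic_value_lt xi n : (exists2 i, (n <= i)%N & xi i <> b.-1 :> nat) ->
  badic_value R xi < (prefix_num xi n).+1%:R / b%:R ^+ n.
Proof.
move=> [i ni xib]; apply: le_lt_trans (badic_value_le xi i.+1) _.
apply: lt_le_trans (badic_sum_ub_noninc xi ni) => /=.
rewrite ltr_pdivrMr ?bX_gt0// exprSr mulrA divfK ?bX_neq0//.
by rewrite -natrM ltr_nat; have := ltn_Zb (xi i); nia.
Qed.

(** Away from infinite runs of [b - 1], a prefix of the expansion is an integer
    part; this is what makes expansions unique. *)
Lemma trunc_badic_value xi n : (exists2 i, (n <= i)%N & xi i <> b.-1 :> nat) ->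
  Num.truncn (badic_value R xi * b%:R ^+ n) = prefix_num xi n.
Proof.
move=> /badic_value_lt h; apply: truncn_def.
by rewrite -ler_pdivrMr ?bX_gt0// badic_value_ge/= -ltr_pdivlMr ?bX_gt0.
Qed.

Lemma invbX_small (e : R) : 0 < e ->
  exists n0, forall n, (n0 <= n)%N -> (b%:R ^+ n)^-1 < e.
Proof.
move=> e_gt0; have bV : `|b%:R^-1| < 1 :> R.
  by rewrite ger0_norm ?invr_ge0 ?ler0n// invf_lt1 ?b_gt0// ltr1n.
have /cvgrPdist_lt/(_ _ e_gt0)[n _ hn] := cvg_geometric 1 bV.
exists n => m nm; have := hn m nm => /=.
by rewrite sub0r normrN mul1r ger0_norm ?exprn_ge0 ?invr_ge0 ?ler0n// exprVn.
Qed.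

Lemma badic_value_max xi : (forall i, xi i = b.-1 :> nat) -> badic_value R xi = 1.
Proof.
move=> h; apply/eqP; rewrite eq_le; have /andP[_ ->] := badic_value01 xi.
have e n : (prefix_num xi n).+1 = (b ^ n)%N.
  elim: n => //= n IH; rewrite h -addnS (prednK (ltnW hb)) expnS -IH mulnS.
  by rewrite addnC.
apply/ler_addgt0Pl => e0 /invbX_small[n /(_ n (leqnn n)) hn].
rewrite -lerBlDl; apply: le_trans (badic_value_ge xi n).
have -> : (prefix_num xi n)%:R = b%:R ^+ n - 1 :> R by rewrite -natrX -e -natr1 addrK.
rewrite mulrBl divff ?bX_neq0// mul1r lerD2l lerN2.
by rewrite ?mul1r ltW.
Qed.

Lemma badic_expansion_value x xi : badic_expansion x xi -> x = badic_value R xi.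
Proof. by move=> [+ _] => /cvg_lim; rewrite /badic_value => <-. Qed.

Lemma badic_value_expansion xi :
  (forall i, xi i = b.-1 :> nat) \/
  (forall n, exists2 i, (n <= i)%N & xi i <> b.-1 :> nat) ->
  badic_expansion (badic_value R xi) xi.
Proof.
move=> h; split; first exact: badic_sum_cvg.
case: h => h; first by rewrite badic_value_max// eqxx.
case: ifP => // /eqP e; have := badic_value_lt (h 0%N).
by rewrite e /= expr0 divr1 ltxx.
Qed.

Lemma badic_expansion_uniq x : is_subset1 [set xi : nat -> 'Z_b | badic_expansion x xi].
Proof.
move=> xi xi' /= h h'; apply/funext => n.
have e := badic_expansion_value h; have e' := badic_expansion_value h'.
move: h h' => [_ +] [_ +]; case: ifP => _ h h'; first by apply/val_inj; rewrite /= h h'.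
apply: (@prefix_num_inj _ _ n.+1) => //.
by rewrite -!trunc_badic_value ?(h n.+1, h' n.+1)// -e -e'.
Qed.

Lemma truncn_divn x : 0 <= x -> (Num.truncn (x * b%:R) %/ b)%N = Num.truncn x.
Proof.
move=> x0; apply/esym/truncn_def.
have xb0 : 0 <= x * b%:R by rewrite mulr_ge0// ltW// b_gt0.
set k := Num.truncn (x * _).
have /andP[k1 k2] : k%:R <= x * b%:R < k.+1%:R by exact: truncn_itv.
apply/andP; split.
  rewrite -(ler_pM2r b_gt0) (le_trans _ k1)// -natrM ler_nat; exact: leq_trunc_div.
rewrite -(ltr_pM2r b_gt0) (lt_le_trans k2)// -natrM ler_nat.
by rewrite ltn_ceil// ltnW.
Qed.

(** The digits of [x] in [[0, 1[], read off from integer parts. *)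
Definition trunc_digits x : nat -> 'Z_b := fun i => inZp (Num.truncn (x * b%:R ^+ i.+1)).

Lemma prefix_num_trunc_digits x n : 0 <= x < 1 ->
  prefix_num (trunc_digits x) n = Num.truncn (x * b%:R ^+ n).
Proof.
move=> /andP[x0 x1]; elim: n => [|n IH].
  by rewrite /= expr0 mulr1; apply/esym/truncn_def; rewrite x0.
rewrite /= Zp_cast// IH exprSr mulrA -[in X in (b * X)%N]truncn_divn; last first.
  by rewrite mulr_ge0// ltW// bX_gt0.
by rewrite [in RHS](divn_eq (Num.truncn (x * b%:R ^+ n * b%:R)) b) mulnC.
Qed.

Lemma trunc_digits_expansion x : 0 <= x < 1 -> badic_expansion x (trunc_digits x).
Proof.
move=> x01; have /andP[x0 x1] := x01; set xi := trunc_digits x.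
have lex n : (prefix_num xi n)%:R / b%:R ^+ n <= x.
  rewrite prefix_num_trunc_digits// ler_pdivrMr ?bX_gt0//.
  by rewrite truncn_le mulr_ge0// ltW// bX_gt0.
have ltx n : x < (prefix_num xi n).+1%:R / b%:R ^+ n.
  rewrite prefix_num_trunc_digits// ltr_pdivlMr ?bX_gt0//.
  by have /andP[] := truncn_itv (mulr_ge0 x0 (ltW (bX_gt0 n))).
split.
  apply/cvgrPdist_lt => e e_gt0; have [n0 hn0] := invbX_small e_gt0.
  exists n0 => // n /= n0n; rewrite badic_sumE ger0_norm ?subr_ge0//.
  apply: lt_trans (hn0 _ n0n); rewrite ltrBlDr.
  by have := ltx n; rewrite -natr1 mulrDl mul1r addrC.
rewrite (lt_eqF x1) => n; apply: contrapT => hN.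
(* if all digits from [n] on were [b - 1], the upper bound of [x] given by a
   prefix would not depend on the prefix, and [x] would equal it *)
have hn i : (n <= i)%N -> xi i = b.-1 :> nat.
  by move=> ni; apply: contrapT => ?; apply: hN; exists i.
have cst m : (n <= m)%N -> (prefix_num xi m).+1%:R / b%:R ^+ m = (prefix_num xi n).+1%:R / b%:R ^+ n :> R.
  elim: m => [|m IH]; first by rewrite leqn0 => /eqP->.
  rewrite leq_eqVlt => /orP[/eqP->//|]; rewrite ltnS => nm; rewrite -IH//.
  have -> : (prefix_num xi m.+1).+1 = (b * (prefix_num xi m).+1)%N.
    by have /= := hn m nm; nia.
  by rewrite natrM exprS -mulf_div divff ?b_neq0// mul1r.
have gap : 0 < (prefix_num xi n).+1%:R / b%:R ^+ n - x by rewrite subr_gt0.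
have [m hm] := invbX_small gap.
have := hm (maxn n m) (leq_maxr _ _).
rewrite -(cst _ (leq_maxl n m)) ltNge lerBlDr -natr1 mulrDl mul1r addrC lerD2l.
by rewrite lex.
Qed.

Lemma digitsP x : 0 <= x <= 1 -> badic_expansion x (digits b x).
Proof.
move=> /andP[x0 x1]; apply: (@xgetPex _ (fun=> 0) [set xi | badic_expansion x xi]).
move: x1; rewrite le_eqVlt => /orP[/eqP->|x1]; last first.
  by exists (trunc_digits x); apply: trunc_digits_expansion; rewrite x0.
pose xi (i : nat) : 'Z_b := inZp b.-1; exists xi.
have h i : xi i = b.-1 :> nat by rewrite val_inZp modn_small// prednK// ltnW.
rewrite -(badic_value_max h); apply: badic_value_expansion; by left.
Qed.

Lemma digitsE x xi : badic_expansion x xi -> digits b x = xi.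
Proof. by move=> h; apply: xget_subset1 => //; exact: badic_expansion_uniq. Qed.

Lemma digitsK x : 0 <= x <= 1 -> badic_value R (digits b x) = x.
Proof. by move=> /digitsP/badic_expansion_value. Qed.

Lemma digits_value xi :
  (forall i, xi i = b.-1 :> nat) \/
  (forall n, exists2 i, (n <= i)%N & xi i <> b.-1 :> nat) ->
  digits b (badic_value R xi) = xi.
Proof. by move=> /badic_value_expansion/digitsE. Qed.

Lemma digits_lt1 x i : 0 <= x < 1 -> digits b x i = trunc_digits x i.
Proof. by move=> /trunc_digits_expansion/digitsE->. Qed.

Lemma digits1 i : digits b (1 : R) i = b.-1 :> nat.
Proof.
have /digitsP[_] : 0 <= (1 : R) <= 1 by rewrite ler01 lexx.
by rewrite eqxx.
Qed.

Lemma digits_out x i : ~~ (0 <= x <= 1) -> digits b x i = 0.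
Proof.
move=> hx; rewrite /digits xgetPN// => xi /badic_expansion_value e.
by move: hx; rewrite e badic_value01.
Qed.

End digits.

(** * Measurability of the digits, of the shift and of the tent map *)

Section digit_measurability.
Context (b : nat).

(** Measurability for maps into the finite ring ['Z_b], seen as a discrete
    space. *)
Definition measurable_digit d (T : measurableType d) (f : T -> 'Z_b) :=
  forall a, measurable [set x | f x = a].

Lemma measurable_digit_cst d (T : measurableType d) (c : 'Z_b) :
  measurable_digit (fun _ : T => c).
Proof.
move=> a; have [->|ca] := eqVneq c a.
  by rewrite (_ : [set _ | _] = setT)//; apply/seteqP; split.
by rewrite (_ : [set _ | _] = set0)//; apply/seteqP; split=> // x /eqP; rewrite (negbTE ca).
Qed.

Lemma measurable_digit_comp d d' (T : measurableType d) (U : measurableType d')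
    (f : U -> 'Z_b) (p : T -> U) :
  measurable_digit f -> measurable_fun setT p -> measurable_digit (f \o p).
Proof. by move=> mf mp a; rewrite -[X in measurable X]setTI; exact: mp (mf a). Qed.

Lemma measurable_digit_op2 d (T : measurableType d) (f g : T -> 'Z_b)
    (h : 'Z_b -> 'Z_b -> 'Z_b) :
  measurable_digit f -> measurable_digit g ->
  measurable_digit (fun x => h (f x) (g x)).
Proof.
move=> mf mg c.
have -> : [set x | h (f x) (g x) = c] = \bigcup_(p in [set p : 'Z_b * 'Z_b | h p.1 p.2 = c])
    ([set x | f x = p.1] `&` [set x | g x = p.2]).
  apply/seteqP; split=> x /=; first by move=> e; exists (f x, g x).
  by move=> [[p q] /= e [-> ->]].
by apply: fin_bigcup_measurable => // p _; apply: measurableI.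
Qed.

Lemma measurable_fun_of_digit d d' (T : measurableType d) (U : measurableType d')
    (f : T -> 'Z_b) (g : 'Z_b -> U) :
  measurable_digit f -> measurable_fun setT (g \o f).
Proof.
move=> mf _ Y mY; rewrite setTI.
have -> : (g \o f) @^-1` Y = \bigcup_(a in [set a | Y (g a)]) [set x | f x = a].
  by apply/seteqP; split=> x /=; [move=> h; exists (f x)|move=> [a + ->]].
by apply: fin_bigcup_measurable.
Qed.

Lemma measurable_digit_if d (T : measurableType d) (P : T -> bool) (f g : T -> 'Z_b) :
  measurable [set x | P x] -> measurable_digit f -> measurable_digit g ->
  measurable_digit (fun x => if P x then f x else g x).
Proof.
move=> mP mf mg a.
have -> : [set x | (if P x then f x else g x) = a] =
   ([set x | P x] `&` [set x | f x = a]) `|` (~` [set x | P x] `&` [set x | g x = a]).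
  apply/seteqP; split=> x /=; first by case: ifP; [left|right].
  by move=> [[-> //]|[/negP/negbTE -> //]].
by apply: measurableU; apply: measurableI => //; exact: measurableC.
Qed.

Context (R : realType) (hb : (1 < b)%N).

Lemma measurable_01 : measurable [set x : measurableTypeR R | 0 <= (x : R) <= 1].
Proof.
have -> : [set x : measurableTypeR R | 0 <= (x : R) <= 1] = `[0, 1]%classic.
  by apply/seteqP; split=> x /=; rewrite in_itv.
exact: measurable_itv.
Qed.

Lemma measurable_digits i :
  measurable_digit (fun x : measurableTypeR R => digits b (x : R) i).
Proof.
have -> : (fun x : measurableTypeR R => digits b (x : R) i) = (fun x : measurableTypeR R =>
    if 0 <= (x : R) < 1 then inZp (Num.truncn ((x : R) * b%:R ^+ i.+1))
    else if (x : R) == 1 then inZp b.-1 else 0).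
  apply/funext => x; case: ifPn => [x01|hx]; first exact: digits_lt1.
  case: eqVneq => [->|x1].
    by apply/val_inj; rewrite /= digits1// Zp_cast// modn_small// prednK// ltnW.
  apply: (digits_out hb); apply: contraNN hx => /andP[-> /=].
  by rewrite le_eqVlt (negbTE x1).
apply: measurable_digit_if.
- have -> : [set x : measurableTypeR R | 0 <= (x : R) < 1] = `[0, 1[%classic.
    by apply/seteqP; split=> x /=; rewrite in_itv.
  exact: measurable_itv.
- move=> a.
  pose t (x : R) : R := (Num.truncn (x * b%:R ^+ i.+1))%:R.
  have mt : measurable_fun setT t.
    apply: nondecreasing_measurable => // x y xy; rewrite ler_nat; apply: le_truncn.
    by rewrite ler_pM2r// bX_gt0.
  have -> : [set x : measurableTypeR R | inZp (Num.truncn ((x : R) * b%:R ^+ i.+1)) = a] =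
      t @^-1` ((fun k : nat => k%:R) @` [set k | inZp k = a]).
    apply/seteqP; split=> x /=; first by move=> <-; exists (Num.truncn (x * b%:R ^+ i.+1)).
    by move=> [k <-] /eqP; rewrite eqr_nat => /eqP->.
  rewrite -[X in measurable X]setTI; apply: mt => //.
  apply: countable_measurable => [z|]; first exact: measurable_set1.
  by apply: (sub_countable (card_image_le _ _)); exact: countableP.
- apply: measurable_digit_if.
  + have -> : [set x : measurableTypeR R | (x : R) == 1] = [set (1 : R)].
      by apply/seteqP; split=> x /= /eqP.
    exact: measurable_set1.
  + exact: measurable_digit_cst.
  + exact: measurable_digit_cst.
Qed.

Lemma measurable_badic_value d (T : measurableType d) (F : T -> nat -> 'Z_b) :
  (forall i, measurable_digit (F^~ i)) ->
  measurable_fun setT (fun x => badic_value R (F x) : measurableTypeR R).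
Proof.
move=> mF; apply: (@measurable_fun_cvg _ _ _ _ (fun n x => badic_sum R (F x) n)).
  move=> n; rewrite /badic_sum; under eq_fun do rewrite seriesEnat/=.
  apply: measurable_sum => i.
  exact: (measurable_fun_of_digit (fun a : 'Z_b => (a : nat)%:R / b%:R ^+ i.+1 : R) (mF i)).
by move=> x _; exact: badic_sum_cvg.
Qed.

(** The maps [x |-> x (+) c] and [tent] are only meaningful on [[0, 1]]; here
    they are extended by the identity, so that they preserve Lebesgue measure
    on the whole line. *)
Definition oplus_ext (x c : R) : R :=
  if (0 <= x <= 1) && (0 <= c <= 1) then oplus b x c else x.

Definition tent_ext (x : R) : R := if 0 <= x <= 1 then tent b x else x.

Lemma measurable_oplus_ext :
  measurable_fun setT (fun z : measurableTypeR R * measurableTypeR R =>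
    oplus_ext z.1 z.2 : measurableTypeR R).
Proof.
rewrite /oplus_ext; apply: measurable_fun_ifT => //.
- apply: (@measurable_fun_bool _ _ _ _ true) => //; rewrite setTI.
  have -> : (fun z : measurableTypeR R * measurableTypeR R =>
     (0 <= (z.1 : R) <= 1) && (0 <= (z.2 : R) <= 1)) @^-1` [set true] =
     [set x : measurableTypeR R | 0 <= (x : R) <= 1] `*` [set x : measurableTypeR R | 0 <= (x : R) <= 1].
    by apply/seteqP; split=> x /=; [move=> /andP|move/andP].
  by apply: measurableX; exact: measurable_01.
- apply: measurable_badic_value => i.
  apply: (measurable_digit_op2 (fun u v => u + v)).
    exact: (measurable_digit_comp (measurable_digits i) measurable_fst).
  exact: (measurable_digit_comp (measurable_digits i) measurable_snd).
Qed.

Lemma measurable_tent_ext :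
  measurable_fun setT (fun x : measurableTypeR R => tent_ext x : measurableTypeR R).
Proof.
rewrite /tent_ext; apply: measurable_fun_ifT => //.
- by apply: (@measurable_fun_bool _ _ _ _ true) => //; rewrite setTI; exact: measurable_01.
- apply: measurable_badic_value => i.
  by apply: (measurable_digit_op2 (fun u v => u - v)); exact: measurable_digits.
Qed.

Lemma oplus01 (x c : R) : 0 <= oplus b x c <= 1.
Proof. exact: badic_value01. Qed.

Lemma tent01 (x : R) : 0 <= tent b x <= 1.
Proof. exact: badic_value01. Qed.

Lemma oplus_ext01 (x c : R) : (0 <= oplus_ext x c <= 1) = (0 <= x <= 1).
Proof.
rewrite /oplus_ext; have [/andP[h _]|//] := boolP ((0 <= x <= 1) && (0 <= c <= 1)).
by rewrite h oplus01.
Qed.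

Lemma tent_ext01 (x : R) : (0 <= tent_ext x <= 1) = (0 <= x <= 1).
Proof. by rewrite /tent_ext; have [h|/negbTE//] := boolP (0 <= x <= 1); rewrite [LHS]tent01. Qed.

End digit_measurability.

(** * Measure preservation in dimension one *)

Section measure_preserving_1d.
Context (R : realType) (b : nat) (hb : (1 < b)%N).
Local Notation leb := (@lebesgue_measure R).
Local Notation mR := (measurableTypeR R).
Implicit Types (xi : nat -> 'Z_b) (x : R).

(** The points whose digits coincide with [c] from some index on. *)
Definition tail_set (c : nat -> 'Z_b) : set mR :=
  [set x | 0 <= (x : R) <= 1 /\ exists n, forall i, (n <= i)%N -> digits b (x : R) i = c i].

Lemma countable_tail_set c : countable (tail_set c).
Proof.
pose f (w : seq 'Z_b) : mR :=
  badic_value R (fun i => if (i < size w)%N then nth 0 w i else c i).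
apply: (@sub_countable _ _ _ (f @` setT)); last first.
  by apply: (sub_countable (card_image_le _ _)); exact: countableP.
apply: subset_card_le => x [x01 [n hn]].
exists (mkseq (digits b (x : R)) n) => //.
rewrite /f -[RHS](digitsK hb x01); congr badic_value; apply/funext => i.
by rewrite size_mkseq; case: ltnP => [i_lt|/hn->//]; rewrite nth_mkseq.
Qed.

Lemma measurable_countable (A : set mR) : countable A -> measurable A.
Proof. by apply: countable_measurable => t; exact: measurable_set1. Qed.

Lemma not_tail_set c x : 0 <= x <= 1 -> ~ tail_set c x ->
  forall n, exists2 i, (n <= i)%N & digits b x i <> c i.
Proof.
move=> x01 h n; apply: contrapT => hn; apply: h; split => //; exists n => i ni.
by apply: contrapT => ?; apply: hn; exists i.
Qed.

Lemma eq_measure_mod_null d (T : measurableType d) (mu : {measure set T -> \bar R})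
    (A B N : set T) : measurable A -> measurable B -> measurable N -> mu N = 0%E ->
  (forall t, ~ N t -> A t <-> B t) -> mu A = mu B.
Proof.
move=> mA mB mN N0 AB.
have le C D : measurable C -> measurable D -> (forall t, ~ N t -> C t -> D t) -> (mu C <= mu D)%E.
  move=> mC mD CD; apply: (@le_trans _ _ (mu (D `|` N))).
    apply: le_measure; rewrite ?inE//; first exact: measurableU.
    by move=> x Cx; have [Nx|Nx] := pselect (N x); [right|left; exact: CD].
  by rewrite measureU0.
by apply/eqP; rewrite eq_le !le// => x Nx; have [] := AB x Nx.
Qed.

Lemma cellP n k x : 0 <= x ->
  (Num.truncn (x * b%:R ^+ n) == k) = (k%:R / b%:R ^+ n <= x < k.+1%:R / b%:R ^+ n).
Proof.
move=> x0; rewrite truncn_eq; last by rewrite mulr_ge0// ltW// (bX_gt0 _ hb).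
by rewrite ler_pdivrMr ?(bX_gt0 _ hb)// ltr_pdivlMr ?(bX_gt0 _ hb).
Qed.

Lemma prefix_num_surj n k : (k < b ^ n)%N -> exists w : nat -> 'Z_b, prefix_num w n = k.
Proof.
move=> kb; exists (trunc_digits b (k%:R / b%:R ^+ n : R)).
rewrite prefix_num_trunc_digits//; last first.
  rewrite divr_ge0 ?ler0n ?(ltW (bX_gt0 R hb n))//=.
  by rewrite ltr_pdivrMr ?(bX_gt0 _ hb)// mul1r -natrX ltr_nat.
by rewrite divfK ?(bX_neq0 _ hb)// natrK.
Qed.

Lemma prefix_num_eqP xi xi' n :
  prefix_num xi n = prefix_num xi' n <-> forall i, (i < n)%N -> xi i = xi' i.
Proof. by split; [exact: (prefix_num_inj hb)|exact: eq_prefix_num]. Qed.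

(** Prescribing the first [n] digits means lying in a half-open interval of
    length [b ^ -n]. *)
Lemma cylinderE w n : [set x : mR | 0 <= (x : R) < 1 /\ forall i, (i < n)%N -> digits b (x : R) i = w i] =
  `[(prefix_num w n)%:R / b%:R ^+ n, (prefix_num w n).+1%:R / b%:R ^+ n[%classic.
Proof.
apply/seteqP; split=> x /=.
  move=> [x01 /prefix_num_eqP].
  have -> : digits b (x : R) = trunc_digits b (x : R) by apply/funext => i; exact: digits_lt1.
  rewrite prefix_num_trunc_digits// => /eqP.
  by rewrite cellP ?in_itv//; case/andP: x01.
rewrite in_itv /= => h.
have x0 : 0 <= (x : R).
  by case/andP: h => + _; apply: le_trans; rewrite divr_ge0 ?ler0n ?(ltW (bX_gt0 R hb n)).
have x01 : 0 <= (x : R) < 1.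
  rewrite x0/=; case/andP: h => _ /lt_le_trans; apply.
  by rewrite ler_pdivrMr ?(bX_gt0 _ hb)// mul1r -natrX ler_nat prefix_num_lt.
split => //; apply/prefix_num_eqP.
have -> : digits b (x : R) = trunc_digits b (x : R) by apply/funext => i; exact: digits_lt1.
by rewrite prefix_num_trunc_digits//; apply/eqP; rewrite cellP.
Qed.

Lemma lebesgue_measure_cylinder w n :
  leb [set x | 0 <= (x : R) < 1 /\ forall i, (i < n)%N -> digits b (x : R) i = w i] =
  ((b%:R ^+ n)^-1)%:E.
Proof.
rewrite cylinderE lebesgue_measure_itv/= lte_fin ltr_pM2r ?invr_gt0 ?(bX_gt0 _ hb)//.
rewrite ltr_nat ltnSn -EFinB; congr EFin.
by rewrite -mulrBl -natr1 addrC addKr mul1r.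
Qed.

Lemma measurable_cylinder w n :
  measurable [set x : mR | 0 <= (x : R) < 1 /\ forall i, (i < n)%N -> digits b (x : R) i = w i].
Proof. by rewrite cylinderE; exact: measurable_itv. Qed.

Lemma measure01 : leb [set x : mR | 0 <= (x : R) <= 1] = 1%E.
Proof.
have -> : [set x : mR | 0 <= (x : R) <= 1] = `[0, 1]%classic.
  by apply/seteqP; split=> x /=; rewrite in_itv.
by rewrite lebesgue_measure_itv/= lte_fin ltr01 -EFinB subr0.
Qed.

(** A map of [[0, 1]] that acts on digit sequences by [F] preserves Lebesgue
    measure as soon as every prescription of the first [n] digits of the image
    has probability [b ^ -n], provided that outside of a countable set [F] does
    not produce an infinite run of [b - 1]. *)
Lemma preserving_of_cylinders (T : R -> R) (F : (nat -> 'Z_b) -> nat -> 'Z_b) (N : set mR) :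
  measurable_fun setT (T : mR -> mR) ->
  (forall x, 0 <= x <= 1 -> T x = badic_value R (F (digits b x))) ->
  (forall x, ~~ (0 <= x <= 1) -> T x = x) ->
  countable N ->
  (forall x, 0 <= x <= 1 -> ~ N x ->
     forall n, exists2 i, (n <= i)%N & F (digits b x) i <> b.-1 :> nat) ->
  (forall w n, measurable [set x : mR | 0 <= (x : R) < 1 /\
      forall i, (i < n)%N -> F (digits b (x : R)) i = w i]) ->
  (forall w n, leb [set x | 0 <= (x : R) < 1 /\
      forall i, (i < n)%N -> F (digits b (x : R)) i = w i] = ((b%:R ^+ n)^-1)%:E) ->
  forall A : set mR, measurable A -> leb (T @^-1` A) = leb A.
Proof.
move=> mT TE Tout cN hN mcyl cyl.
pose I : set mR := [set x | 0 <= (x : R) <= 1].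
have mI : measurable I by exact: measurable_01.
have T01 x : 0 <= x <= 1 -> 0 <= T x <= 1 by move=> /TE->; exact: badic_value01.
have mTA (A : set mR) : measurable A -> measurable (T @^-1` A).
  by move=> mA; rewrite -[X in measurable X]setTI; exact: mT.
(* the law of [T x] for [x] uniform on [[0, 1]]; it is compared with Lebesgue
   measure on the cells of level [n], then on the rays *)
pose nu (A : set mR) : \bar R := leb (T @^-1` A `&` I).
have nuC n k : (k < b ^ n)%N ->
    nu `[k%:R / b%:R ^+ n, k.+1%:R / b%:R ^+ n[%classic = ((b%:R ^+ n)^-1)%:E.
  move=> /prefix_num_surj[w wk]; rewrite -(cyl w n) /nu.
  apply: (@eq_measure_mod_null _ _ _ _ _ (N `|` [set 1])) => //.
  - by apply: measurableI => //; apply: mTA; exact: measurable_itv.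
  - by apply: measurableU; apply: measurable_countable => //; exact: countable1.
  - rewrite measureU0//; first exact: countable_lebesgue_measure0.
    + exact: measurable_countable.
    + exact: lebesgue_measure_set1.
  move=> x /= /not_orP[Nx x1].
  have key : 0 <= (x : R) <= 1 -> (k%:R / b%:R ^+ n <= T x < k.+1%:R / b%:R ^+ n) <->
      (forall i, (i < n)%N -> F (digits b (x : R)) i = w i).
    move=> x01; rewrite -cellP; last by case/andP: (T01 _ x01).
    rewrite -prefix_num_eqP wk TE// trunc_badic_value//; last exact: hN.
    by split => /eqP.
  split.
    move=> [+ x01]; rewrite /= in_itv/= => /key h; split; last exact: h.
    by have /andP[-> xle] := x01; rewrite lt_neqAle xle andbT; apply/eqP.
  move=> [x01 h].
  have x01' : 0 <= (x : R) <= 1 by have /andP[-> /ltW->] := x01.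
  by split => //=; rewrite in_itv/=; apply/key.
have nuK n k : (k <= b ^ n)%N -> nu `[0, k%:R / b%:R ^+ n[%classic = (k%:R / b%:R ^+ n)%:E.
  elim: k => [_|k IH kb]; first by rewrite mul0r set_itvco0 /nu preimage_set0 set0I measure0.
  have k0 : 0 <= k%:R / b%:R ^+ n :> R by rewrite divr_ge0 ?ler0n ?(ltW (bX_gt0 R hb n)).
  have kk : k%:R / b%:R ^+ n <= k.+1%:R / b%:R ^+ n :> R.
    by rewrite ler_pM2r ?invr_gt0 ?(bX_gt0 _ hb)// ler_nat.
  have -> : `[0, k.+1%:R / b%:R ^+ n[%classic = `[0, k%:R / b%:R ^+ n[%classic `|`
       `[k%:R / b%:R ^+ n, k.+1%:R / b%:R ^+ n[%classic :> set mR.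
    apply/seteqP; split=> x /=; rewrite !in_itv/=.
      by move=> /andP[x0 xk]; have [h|h] := ltP (x : R) (k%:R / b%:R ^+ n); [left|right]; rewrite ?x0// xk.
    by move=> [/andP[-> /lt_le_trans->]//|/andP[/(le_trans k0)-> ->]].
  rewrite /nu preimage_setU setIUl measureU.
  - rewrite -[X in (X + _)%E]/(nu _) -[X in (_ + X)%E]/(nu _) nuC// IH; last exact: ltnW.
    by rewrite -EFinD -[X in _ + X]mul1r -mulrDl natr1.
  - by apply: measurableI => //; apply: mTA; exact: measurable_itv.
  - by apply: measurableI => //; apply: mTA; exact: measurable_itv.
  - apply/seteqP; split => // x /=; rewrite !in_itv/= => -[[/andP[_ h1] _] [/andP[h2 _] _]].
    by have := lt_le_trans h1 h2; rewrite ltxx.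
have nuI (A : set mR) : measurable A -> nu A = leb (A `&` I).
  move=> mA.
  pose m1 : {measure set mR -> \bar R} :=
    measure_function_pushforward__canonical__measure_function_Measure (mrestr leb mI) mT.
  pose m2 : {measure set mR -> \bar R} := mrestr leb mI.
  rewrite -[LHS]/(m1 A) -[RHS]/(m2 A).
  apply: (@measure_unique _ R mR (@RGenInftyO.G R) (fun n => `]-oo, n%:R[%classic) _ _ _ _ m1 m2).
  - exact: RGenInftyO.measurableE.
  - move=> _ _ [x ->] [y ->]; exists (Num.min x y).
    by apply/seteqP; split=> z /=; rewrite !in_itv/= lt_min => /andP.
  - by move=> n; exists n%:R.
  - apply/seteqP; split=> x // _; exists (Num.truncn `|x|).+1 => //=.
    rewrite in_itv/= (le_lt_trans (ler_norm _))//.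
    by have /andP[] := truncn_itv (normr_ge0 x).
  - move=> _ [t ->]; rewrite [LHS]/(nu _) [RHS]/(leb (_ `&` _)).
    have [t0|t0] := leP t 0.
      have e1 : T @^-1` `]-oo, t[%classic `&` I = set0.
        apply/seteqP; split=> // x /=; rewrite in_itv/= => -[xt /T01/andP[/(le_lt_trans)/(_ xt)]].
        by rewrite ltNge t0.
      have e2 : (`]-oo, t[%classic : set mR) `&` I = set0.
        apply/seteqP; split=> // x /=; rewrite in_itv/= => -[xt /andP[/(le_lt_trans)/(_ xt)]].
        by rewrite ltNge t0.
      by rewrite /nu e1 e2.
    have [t1|t1] := ltP 1 t.
      congr (leb _); apply/seteqP; split=> x /=; rewrite !in_itv/= => -[_ x01]; split => //.
        by case/andP: x01 => _ /le_lt_trans->.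
      by case/andP: (T01 _ x01) => _ /le_lt_trans->.
    have e3 : leb ((`]-oo, t[%classic : set mR) `&` I) = t%:E.
      have -> : (`]-oo, t[%classic : set mR) `&` I = `[0, t[%classic.
        apply/seteqP; split=> x /=; rewrite !in_itv/=; first by move=> [-> /andP[->]].
        by move=> /andP[x0 xt]; split => //; rewrite /I/= x0/= ltW// (lt_le_trans xt).
      by rewrite lebesgue_measure_itv/= lte_fin t0 -EFinB subr0.
    have e4 : nu `]-oo, t[%classic = nu `[0, t[%classic.
      congr (leb _); apply/seteqP; split=> x /=; rewrite !in_itv/=; last by move=> [/andP[_ xt] x01]; split.
      by move=> [xt x01]; split => //; rewrite xt andbT; case/andP: (T01 _ x01).
    rewrite [RHS]e3 [LHS]e4.
    have nule (B C : set mR) : measurable B -> measurable C -> B `<=` C -> (nu B <= nu C)%E.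
      move=> mB mC BC; apply: le_measure; rewrite ?inE; try by apply: measurableI => //; exact: mTA.
      by apply: setSI => x; exact: BC.
    have nufin : nu `[0, t[%classic \is a fin_num.
      rewrite ge0_fin_numE ?measure_ge0//; apply: (@le_lt_trans _ _ (leb I)).
        apply: le_measure; rewrite ?inE//; apply: measurableI => //; apply: mTA; exact: measurable_itv.
      by rewrite measure01 ltry.
    rewrite -(fineK nufin); congr EFin; set v := fine _.
    have vle n : v <= t + (b%:R ^+ n)^-1 /\ t <= v + (b%:R ^+ n)^-1.
      have tb0 : 0 <= t * b%:R ^+ n by rewrite mulr_ge0 ?(ltW t0) ?(ltW (bX_gt0 R hb n)).
      set k := Num.truncn (t * b%:R ^+ n).
      have /andP[k1 k2] : k%:R / b%:R ^+ n <= t < k.+1%:R / b%:R ^+ n.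
        by rewrite -cellP ?(ltW t0).
      have kS : k.+1%:R / b%:R ^+ n = k%:R / b%:R ^+ n + (b%:R ^+ n)^-1 :> R.
        by rewrite -natr1 mulrDl mul1r.
      have kb : (k <= b ^ n)%N.
        rewrite -(ler_nat R) natrX -[X in _ <= X]mul1r -ler_pdivrMr ?(bX_gt0 _ hb)//.
        exact: le_trans k1 t1.
      split; last first.
        rewrite (le_trans (ltW k2))// kS lerD2r -lee_fin fineK// -nuK//.
        apply: nule; [exact: measurable_itv|exact: measurable_itv|].
        by move=> x /=; rewrite !in_itv/= => /andP[-> /lt_le_trans->].
      (* [k = b ^ n] means [t = 1], where there is no cell to the right *)
      have [kb'|kb'] := leqP k.+1 (b ^ n)%N; last first.
        have e : t = 1.
          apply/eqP; rewrite eq_le t1/= (le_trans _ k1)// ler_pdivlMr ?(bX_gt0 _ hb)//.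
          by rewrite mul1r -natrX ler_nat.
        rewrite e (@le_trans _ _ 1)// ?lerDl ?invr_ge0 ?(ltW (bX_gt0 R hb n))//.
        rewrite -lee_fin fineK// -measure01; apply: le_measure; rewrite ?inE//.
        by apply: measurableI => //; apply: mTA; exact: measurable_itv.
      apply: (@le_trans _ _ (k.+1%:R / b%:R ^+ n)); last by rewrite kS lerD2r.
      rewrite -lee_fin fineK// -nuK//.
      apply: nule; [exact: measurable_itv|exact: measurable_itv|].
      by move=> x /=; rewrite !in_itv/= => /andP[-> /lt_trans->].
    apply/eqP; rewrite eq_le; apply/andP; split; apply/ler_addgt0Pr => e /(invbX_small hb)[n /(_ n (leqnn n)) hn].
      by apply: le_trans (proj1 (vle n)) _; rewrite lerD2l ltW.
    by apply: le_trans (proj2 (vle n)) _; rewrite lerD2l ltW.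
  - move=> k; apply: (@le_lt_trans _ _ (leb I)); last by rewrite measure01 ltry.
    apply: le_measure; rewrite ?inE//; apply: measurableI => //; apply: mTA; exact: measurable_itv.
  - exact: mA.
move=> A mA.
rewrite (measureDI leb (mTA _ mA) mI) (measureDI leb mA mI).
congr (_ + _)%E; last exact: nuI.
congr (leb _); apply/seteqP; split=> x /= [h /negP x01]; split; try exact/negP.
  by rewrite -(Tout x).
by rewrite (Tout x).
Qed.

Lemma eq_inZp_max (a : 'Z_b) : (a = b.-1 :> nat) <-> a = -1.
Proof.
have e : (-1 : 'Z_b) = b.-1 :> nat.
  move: (-1 : 'Z_b) (addNr (1 : 'Z_b)) => a' /(congr1 (@nat_of_ord _)).
  rewrite val_addZp// => /eqP /dvdn_leq; rewrite addn1 => /(_ isT).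
  by have := ltn_Zb hb a'; lia.
by split => [h|->//]; apply: val_inj; rewrite [LHS]h [RHS]e.
Qed.

Lemma oplus_ext_preserving (c : R) : 0 <= c <= 1 -> forall A : set mR, measurable A ->
  leb ((fun x : mR => oplus_ext b x c : mR) @^-1` A) = leb A.
Proof.
move=> c01.
apply: (@preserving_of_cylinders _ (fun xi i => xi i + digits b c i)
         (tail_set (fun i => -1 - digits b c i))).
- exact: (measurableT_comp (measurable_oplus_ext hb)
    (measurable_fun_pair (@measurable_id _ mR setT) (measurable_cst (c : mR)))).
- by move=> x x01; rewrite /oplus_ext x01 c01.
- by move=> x /negbTE x01; rewrite /oplus_ext x01.
- exact: countable_tail_set.
- move=> x x01 /not_tail_set h n; have [i ni hi] := h x01 n.
  by exists i => // /eq_inZp_max e; apply: hi; rewrite -e addrK.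
- move=> w n; have := measurable_cylinder (fun i => w i - digits b c i) n.
  congr measurable; apply/seteqP; split=> x /= [x01 h]; split => // i /h.
    by move=> ->; rewrite subrK.
  by move=> <-; rewrite addrK.
- move=> w n; rewrite -(lebesgue_measure_cylinder (fun i => w i - digits b c i) n).
  congr (leb _); apply/seteqP; split=> x /= [x01 h]; split => // i /h.
    by move=> <-; rewrite addrK.
  by move=> ->; rewrite subrK.
Qed.

(** Prescribing the first [n] digits of [tent x] leaves the first digit of [x]
    free and then determines the next [n] digits. *)
Lemma tent_cylinderE (w : nat -> 'Z_b) n :
  [set x : mR | 0 <= (x : R) < 1 /\
    forall i, (i < n)%N -> digits b (x : R) i.+1 - digits b (x : R) 0 = w i] =
  \bigcup_(a in [set: 'Z_b]) [set x : mR | 0 <= (x : R) < 1 /\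
    forall i, (i < n.+1)%N -> digits b (x : R) i = if i is i'.+1 then w i' + a else a].
Proof.
apply/seteqP; split=> x /=.
  move=> [x01 h]; exists (digits b (x : R) 0) => //; split => // -[//|i]; rewrite ltnS => /h <-.
  by rewrite subrK.
move=> [a _ [x01 h]]; split => // i i_lt.
by rewrite (h i.+1)// (h 0%N)// addrK.
Qed.

Lemma tent_ext_preserving (A : set mR) : measurable A ->
  leb ((fun x : mR => tent_ext b x : mR) @^-1` A) = leb A.
Proof.
apply: (@preserving_of_cylinders _ (fun xi i => xi i.+1 - xi 0)
         (\bigcup_(a in [set: 'Z_b]) tail_set (fun=> a))).
- exact: measurable_tent_ext.
- by move=> x x01; rewrite /tent_ext x01.
- by move=> x /negbTE x01; rewrite /tent_ext x01.
- by apply: bigcup_countable => // a _; exact: countable_tail_set.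
- move=> x x01 hx n; apply: contrapT => hn; apply: hx.
  exists (digits b x 0 - 1) => //; split => //; exists n.+1 => -[//|i]; rewrite ltnS => ni.
  apply: contrapT => e; apply: hn; exists i => // /eq_inZp_max e'; apply: e.
  by rewrite addrC -e' subrK.
- by move=> w n; rewrite tent_cylinderE; apply: fin_bigcup_measurable => // a _; exact: measurable_cylinder.
move=> w n; rewrite tent_cylinderE measure_fin_bigcup//.
- transitivity (\sum_(a \in [set: 'Z_b]) ((b%:R ^+ n.+1 : R)^-1)%:E)%E.
    apply: eq_fsbigr => a _.
    exact: (lebesgue_measure_cylinder (fun i => if i is i'.+1 then w i' + a else a) n.+1).
  rewrite (_ : [set: 'Z_b] = [set` enum 'Z_b]); last first.
    by apply/seteqP; split=> a //= _; rewrite mem_enum.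
  rewrite -fsbig_seq ?enum_uniq// sumEFin big_enum/= sumr_const card_ord Zp_cast//.
  rewrite exprS invfM -[_ *+ b]mulr_natr mulrAC mulVf ?mul1r//; exact: b_neq0.
- exact: finite_finset.
- move=> a a' _ _ [x [/= [_ h] [_ h']]]; by rewrite -(h 0%N)// -(h' 0%N).
- by move=> a _; exact: measurable_cylinder.
Qed.
End measure_preserving_1d.

(** * Measure-preserving maps of the cube *)

Section preserving.
Context (R : realType).
Local Open Scope ereal_scope.

(** [f] preserves the measure [mu]. *)
Definition preserving d (T : measurableType d) (mu : set T -> \bar R) (f : T -> T) :=
  measurable_fun setT f /\ forall A, measurable A -> mu (f @^-1` A) = mu A.

Lemma preserving_id d (T : measurableType d) (mu : set T -> \bar R) : preserving mu id.
Proof. by split; [exact: measurable_id|]. Qed.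

Section integral.
Context d (T : measurableType d) (mu : {measure set T -> \bar R}) (f : T -> T).
Hypothesis pf : preserving mu f.

Lemma ge0_integral_preserving (g : T -> \bar R) : measurable_fun setT g ->
  (forall x, 0 <= g x) -> \int[mu]_x g (f x) = \int[mu]_x g x.
Proof.
move=> mg g0; have [mf fE] := pf.
pose nu := measure_function_pushforward__canonical__measure_function_Measure mu mf.
rewrite -[RHS](_ : \int[nu]_x g x = _); last by apply: eq_measure_integral => A mA _; exact: fE.
by rewrite [RHS](ge0_integral_pushforward mf)// preimage_setT.
Qed.

Lemma integrable_preserving (g : T -> \bar R) :
  mu.-integrable setT g -> mu.-integrable setT (g \o f).
Proof.
move=> /integrableP[mg goo]; have [mf fE] := pf; apply/integrableP; split.
  exact: measurableT_comp.
rewrite (ge0_integral_preserving (g := fun x => `|g x|))//.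
exact: measurableT_comp.
Qed.

Lemma integral_preserving (g : T -> \bar R) : mu.-integrable setT g ->
  \int[mu]_x g (f x) = \int[mu]_x g x.
Proof.
move=> /[dup] ig /integrable_preserving igf; have [mf fE] := pf.
have mg : measurable_fun setT g by case/integrableP: ig.
pose nu := measure_function_pushforward__canonical__measure_function_Measure mu mf.
rewrite -[RHS](_ : \int[nu]_x g x = _); last by apply: eq_measure_integral => A mA _; exact: fE.
by rewrite [RHS](integral_pushforward mf)// preimage_setT.
Qed.

End integral.

Lemma preserving_prod d1 d2 (T1 : measurableType d1) (T2 : measurableType d2)
    (m1 : {sigma_finite_measure set T1 -> \bar R})
    (m2 : {sigma_finite_measure set T2 -> \bar R}) f1 f2 :
  preserving m1 f1 -> preserving m2 f2 ->
  preserving (m1 \x m2) (fun z => (f1 z.1, f2 z.2)).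
Proof.
move=> [mf1 f1E] [mf2 f2E].
have mf : measurable_fun setT (fun z : T1 * T2 => (f1 z.1, f2 z.2)).
  by apply: measurable_fun_pair; apply: measurableT_comp.
split => // A mA.
pose nu := measure_function_pushforward__canonical__measure_function_Measure (m1 \x m2) mf.
rewrite -[LHS]/(nu A) (@product_measure_unique _ _ _ _ _ m1 m2 nu)// => B C mB mC.
have mp d (T : measurableType d) (h : T -> T) (X : set T) :
    measurable_fun setT h -> measurable X -> measurable (h @^-1` X).
  by move=> mh mX; rewrite -[X in measurable X]setTI; exact: mh.
rewrite -f1E// -f2E// -product_measure1E//; exact: mp.
Qed.

Local Notation leb := (@lebesgue_measure R).
Local Notation mR := (measurableTypeR R).

(** The coordinatewise action of the family [F]. *)
Definition vec_map s (F : nat -> mR -> mR) (x : vecR R s) : vecR R s :=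
  [tuple F j (tnth x j) | j < s].

Lemma measurable_vec_map s F : (forall j, measurable_fun setT (F j)) ->
  measurable_fun setT (@vec_map s F).
Proof.
move=> mF; apply/measurable_fun_tnthP => j.
rewrite (_ : _ \o _ = F j \o (fun x => tnth x j)); last first.
  by apply/funext => x /=; rewrite tnth_mktuple.
by apply: measurableT_comp => //; exact: measurable_tnth.
Qed.

Lemma preserving_vec_map s F : (forall j, preserving leb (F j)) ->
  preserving (lebn R s) (@vec_map s F).
Proof.
move=> pF; split; first by apply: measurable_vec_map => j; case: (pF j).
elim: s F pF => [|s IH] F pF A mA.
  by congr (_ _); apply/seteqP; split=> x /=; rewrite (tuple0 (vec_map _ _)) (tuple0 x).
have mC : measurable ((@consp R s) @^-1` A).
  by rewrite -[X in measurable X]setTI; exact: measurable_consp.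
have pF' : preserving (lebn R s) (@vec_map s (fun j => F j.+1)).
  split; first by apply: measurable_vec_map => j; case: (pF j.+1).
  by apply: IH => j; exact: pF.
have [_ /(_ _ mC)] := preserving_prod (pF 0%N) pF'.
rewrite /= /lebn_step /pushforward => <-; congr (_ _).
apply/seteqP; split=> -[a t] /=; congr A; apply: eq_from_tnth => j;
  rewrite tnth_mktuple /consp; case: (unliftP ord0 j) => [i|] ->;
  by rewrite ?tnthS ?tnth0 ?tnth_mktuple.
Qed.

Lemma lebn_coord_null s (i : 'I_s) (N : set mR) : measurable N -> leb N = 0 ->
  lebn R s [set x | N (tnth x i)] = 0.
Proof.
move=> mN N0.
have -> : [set x : vecR R s | N (tnth x i)] =
    [set x | forall j : 'I_s, (if j == i :> nat then N else setT) (tnth x j)].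
  apply/seteqP; split=> x /=; last by move=> /(_ i); rewrite eqxx.
  by move=> Nx j; case: eqP => // /val_inj ->.
rewrite (@lebn_box R s (fun j => if j == i :> nat then N else setT)); last first.
  by move=> j; case: ifP.
by rewrite (bigD1 i)//= eqxx N0 mul0e.
Qed.

Lemma ae_lebn_coord s (i : 'I_s) (P : mR -> Prop) (N : set mR) :
  countable N -> (forall x, ~ N x -> P x) ->
  {ae lebn R s, forall x, P (tnth x i)}.
Proof.
move=> cN h.
have mN : measurable N by apply: countable_measurable => // t; exact: measurable_set1.
exists [set x | N (tnth x i)]; split.
- by rewrite -[X in measurable X]setTI; exact: measurable_tnth.
- by apply: lebn_coord_null => //; exact: countable_lebesgue_measure0.
- by move=> x /= hx; apply: contrapT => Nx; apply: hx; exact: h.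
Qed.

Lemma ae_prod_fst d1 d2 (T1 : measurableType d1) (T2 : measurableType d2)
    (m1 : {sigma_finite_measure set T1 -> \bar R})
    (m2 : {sigma_finite_measure set T2 -> \bar R}) (P : T1 -> Prop) :
  {ae m1, forall x, P x} -> {ae m1 \x m2, forall z, P z.1}.
Proof.
move=> [N [mN N0 h]]; exists (N `*` setT); split.
- exact: measurableX.
- transitivity (m1 N * m2 setT)%E; first exact: product_measure1E.
  by rewrite [X in X * _]N0 mul0e.
- by move=> z /= hz; split => //; apply: h.
Qed.

Lemma ae_prod_snd d1 d2 (T1 : measurableType d1) (T2 : measurableType d2)
    (m1 : {sigma_finite_measure set T1 -> \bar R})
    (m2 : {sigma_finite_measure set T2 -> \bar R}) (P : T2 -> Prop) :
  {ae m2, forall x, P x} -> {ae m1 \x m2, forall z, P z.2}.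
Proof.
move=> [N [mN N0 h]]; exists (setT `*` N); split.
- exact: measurableX.
- transitivity (m1 setT * m2 N)%E; first exact: product_measure1E.
  by rewrite [X in _ * X]N0 mule0.
- by move=> z /= hz; split => //; apply: h.
Qed.

End preserving.

(** * Walsh functions as characters of digit sequences *)

Section walsh.
Context (R : realType) (b : nat) (hb : (1 < b)%N).
Local Notation w := (omega R b).

Lemma omegaX n : w ^+ n =
  (cos (n%:R * (2 * pi / b%:R)) +i* sin (n%:R * (2 * pi / b%:R)))%C.
Proof.
elim: n => [|n IH]; first by rewrite expr0 mul0r cos0 sin0.
rewrite exprS IH /omega -(@natr1 _ n) (mulrDl n%:R 1) mul1r cosD sinD.
by apply/eqP; rewrite eq_complex /=; apply/andP; split; apply/eqP; ring.
Qed.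

Lemma omega_expb : w ^+ b = 1.
Proof.
by rewrite omegaX mulrC divfK ?b_neq0// mulr_natl cos2pi sin2pi.
Qed.

Lemma omega_modn n : w ^+ (n %% b) = w ^+ n.
Proof. by rewrite [in RHS](divn_eq n b) exprD mulnC exprM omega_expb expr1n mul1r. Qed.

Lemma norm_omega : `|w| = 1.
Proof. by rewrite normc_def /omega /= cos2Dsin2 sqrtr1. Qed.

Lemma omega_neq1 n : (0 < n < b)%N -> w ^+ n != 1.
Proof.
move=> /andP[n0 nb]; rewrite omegaX; apply/negP; rewrite eq_complex /= => /andP[/eqP h _].
have e : n%:R * (2 * pi / b%:R) = (n%:R * (pi / b%:R)) *+ 2 :> R by rewrite -mulr_natr; ring.
have p0 : 0 < n%:R * (pi / b%:R) :> R.
  by rewrite mulr_gt0 ?ltr0n// divr_gt0 ?pi_gt0// b_gt0.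
have ppi : n%:R * (pi / b%:R) < pi :> R.
  by rewrite mulrCA gtr_pMr ?pi_gt0// ltr_pdivrMr ?b_gt0// mul1r ltr_nat.
have : 0 < sin (n%:R * (pi / b%:R) : R) by apply: sin_gt0_pi; rewrite p0.
move: h; rewrite e cos_mulr2n => h s0.
have := cos2Dsin2 (n%:R * (pi / b%:R) : R); have : 0 < sin (n%:R * (pi / b%:R) : R) ^+ 2 by rewrite exprn_gt0.
lra.
Qed.

Lemma mul_omega_conj : w * w^* = 1.
Proof. by rewrite -normCK norm_omega expr1n. Qed.

(** The character [a |-> omega ^ a] of the additive group ['Z_b]. *)
Definition omegaZ (a : 'Z_b) : R[i] := w ^+ a.

Lemma omegaZD a c : omegaZ (a + c) = omegaZ a * omegaZ c.
Proof. by rewrite /omegaZ val_addZp// omega_modn exprD. Qed.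

Lemma omegaZ0 : omegaZ 0 = 1. Proof. by []. Qed.

Lemma omegaZ_nat n : omegaZ n%:R = w ^+ n.
Proof. by rewrite /omegaZ val_Zp_nat// omega_modn. Qed.

Lemma omegaZ_eq1 a : omegaZ a = 1 -> a = 0.
Proof.
move=> h; apply/eqP; apply: contraT => a0; suff : omegaZ a != 1 by rewrite h eqxx.
by apply: omega_neq1; rewrite ltn_Zb// andbT lt0n; apply: contra a0 => /eqP e; apply/eqP/val_inj.
Qed.

Lemma omegaZ_conj a : omegaZ a * (omegaZ a)^* = 1.
Proof. by rewrite /omegaZ rmorphXn -exprMn mul_omega_conj expr1n. Qed.

Lemma omegaZ_inj : injective omegaZ.
Proof.
move=> a c e; apply/eqP; rewrite -subr_eq0; apply/eqP/omegaZ_eq1.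
rewrite -[LHS]mulr1 -(omegaZ_conj c) mulrA -omegaZD subrK e.
by [].
Qed.

Lemma natr_Zp_inj n m : (n < b)%N -> (m < b)%N -> n%:R = m%:R :> 'Z_b -> n = m.
Proof.
by move=> nb mb /(congr1 val); rewrite /= !val_Zp_nat// !modn_small.
Qed.

Lemma omegaZ_sum I (r : seq I) (P : pred I) (F : I -> 'Z_b) :
  omegaZ (\sum_(i <- r | P i) F i) = \prod_(i <- r | P i) omegaZ (F i).
Proof. by elim/big_rec2 : _ => [|i y1 y2 _ <-]; rewrite ?omegaZ0// omegaZD. Qed.

Lemma nat_digit_ge k i : (k <= i)%N -> nat_digit b k i = 0%N.
Proof.
move=> ki; rewrite /nat_digit divn_small ?mod0n//.
by apply: (leq_ltn_trans ki); exact: ltn_expl.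
Qed.

Lemma nat_digitS k i : nat_digit b k i.+1 = nat_digit b (k %/ b) i.
Proof. by rewrite /nat_digit expnS divnMA. Qed.

Lemma nat_digit_inj k l : (forall i, nat_digit b k i = nat_digit b l i) -> k = l.
Proof.
elim/ltn_ind : k l => k IH l h.
have e0 : (k %% b = l %% b)%N by have := h 0%N; rewrite /nat_digit expn0 !divn1.
have [k0|k0] := posnP k; last first.
  rewrite (divn_eq k b) (divn_eq l b) e0; congr (_ * _ + _)%N.
  apply: IH; first by rewrite ltn_Pdiv.
  by move=> i; rewrite -!nat_digitS.
apply/esym; move: h; rewrite k0 {k0 k IH e0} => h.
elim/ltn_ind : l h => l IH h; have [//|l0] := posnP l.
have e0 : (l %% b = 0)%N by have := h 0%N; rewrite /nat_digit expn0 !divn1 mod0n.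
rewrite (divn_eq l b) e0 addn0 (IH (l %/ b)%N) ?ltn_Pdiv// => i.
by rewrite -nat_digitS -h /nat_digit !div0n.
Qed.

(** The exponent of [omega] in [wal k x], as a ['Z_b]-linear form in the digits
    of [x]; any cut-off [m] beyond the digits of [k] gives the same value. *)
Definition walsh_form (k m : nat) (xi : nat -> 'Z_b) : 'Z_b :=
  \sum_(i < m) (nat_digit b k i)%:R * xi i.

Lemma walsh_formE k m xi : (k <= m)%N -> walsh_form k m xi = walsh_form k k xi.
Proof.
move=> km; rewrite /walsh_form -(big_mkord xpredT (fun i => (nat_digit b k i)%:R * xi i)).
rewrite (big_cat_nat (leq0n k) km)//=.
rewrite -[RHS]addr0 -[in RHS](big_mkord xpredT (fun i => (nat_digit b k i)%:R * xi i)).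
congr (_ + _); rewrite big_nat_cond big1//.
by move=> i /andP[/andP[ki _] _]; rewrite nat_digit_ge// mul0r.
Qed.

Lemma walE k m (x : R) : (k <= m)%N -> wal b k x = omegaZ (walsh_form k m (digits b x)).
Proof.
move=> km; rewrite walsh_formE// /wal /walsh_form -omegaZ_nat; congr omegaZ.
rewrite natr_sum; apply: eq_bigr => i _; rewrite natrM; congr (_ * _).
by rewrite natr_Zp.
Qed.

Lemma wal_add k (x y z : R) : (forall i, digits b z i = digits b x i + digits b y i) ->
  wal b k z = wal b k x * wal b k y.
Proof.
move=> h; rewrite !(walE _ (leqnn k)) -omegaZD; congr omegaZ.
by rewrite /walsh_form -big_split; apply: eq_bigr => i _; rewrite h mulrDr.
Qed.

Lemma sum_of_digitsE k m : (k <= m)%N ->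
  (\sum_(i < m) (nat_digit b k i)%:R : 'Z_b) = (sum_of_digits b k)%:R.
Proof.
move=> km; have := walsh_formE (fun=> 1) km; rewrite /walsh_form.
under eq_bigr do rewrite mulr1; move=> ->.
by rewrite natr_sum; apply: eq_bigr => i _; rewrite mulr1.
Qed.

Lemma dvdn_natr_Zp n : (b %| n)%N = ((n%:R : 'Z_b) == 0).
Proof. by rewrite -(inj_eq val_inj) /= val_Zp_nat. Qed.

Lemma wal_tent k (x z : R) : (b %| sum_of_digits b k)%N ->
  (forall i, digits b z i = digits b x i.+1 - digits b x 0) ->
  wal b (k %/ b) z = wal b k x.
Proof.
rewrite dvdn_natr_Zp => /eqP dk h.
rewrite (walE _ (leq_div k b)) (walE _ (leqnSn k)); congr omegaZ.
have := sum_of_digitsE (leqnSn k); rewrite dk /walsh_form !big_ord_recl /= => /eqP.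
rewrite addr_eq0 => /eqP ->; rewrite mulNr mulr_suml addrC -sumrB.
by apply: eq_bigr => i _; rewrite h -nat_digitS mulrBr.
Qed.

Lemma wal_conj k (x : R) : wal b k x * (wal b k x)^* = 1.
Proof. by rewrite (walE _ (leqnn k)) omegaZ_conj. Qed.

Lemma vec_wal_conj s k (x : vecR R s) : vec_wal b k x * (vec_wal b k x)^* = 1.
Proof.
rewrite /vec_wal rmorph_prod -big_split /=.
by apply: big1 => j _; exact: wal_conj.
Qed.

Lemma wal0 (x : R) : wal b 0 x = 1.
Proof. by rewrite /wal big_ord0. Qed.

(** [unit_shift i] has the single nonzero digit [1], at position [i];
    [all_ones] has all its digits equal to [1]. *)
Definition unit_shift (i : nat) : R := badic_value R (fun j => if j == i then 1 : 'Z_b else 0).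
Definition all_ones : R := badic_value R (fun=> 1 : 'Z_b).

Lemma digits_unit_shift i : digits b (unit_shift i) = fun j => if j == i then 1 else 0.
Proof.
apply: digits_value => //; right => n; exists (maxn n i.+1); first exact: leq_maxl.
rewrite gtn_eqF ?leq_maxr// => /= e; move: hb; lia.
Qed.

Lemma digits_all_ones : digits b all_ones = fun=> 1.
Proof.
apply: digits_value => //.
have e1 : (1 : 'Z_b) = 1%N :> nat by rewrite /= Zp_cast// modn_small.
have [b2|b2] := eqVneq b 2%N; first by left => i; rewrite e1 b2.
right => n; exists n => //; rewrite e1 => e; move: b2; rewrite -(prednK (ltnW hb)) -e; by [].
Qed.

Lemma wal_unit_shift k i : wal b k (unit_shift i) = omegaZ (nat_digit b k i)%:R.
Proof.
rewrite (walE _ (leq_maxl k i.+1)) digits_unit_shift /walsh_form; congr omegaZ.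
have im : (i < maxn k i.+1)%N by exact: leq_maxr.
rewrite (bigD1 (Ordinal im))//= eqxx mulr1 big1 ?addr0// => j.
by rewrite -val_eqE /= => /negbTE ->; rewrite mulr0.
Qed.

Lemma wal_all_ones k : wal b k all_ones = omegaZ (sum_of_digits b k)%:R.
Proof.
rewrite (walE _ (leqnn k)) digits_all_ones -(sum_of_digitsE (leqnn k)).
by congr omegaZ; apply: eq_bigr => i _; rewrite mulr1.
Qed.

Lemma measurable_wal k d (T : measurableType d) (f : R[i] -> T) :
  measurable_fun setT (fun x : measurableTypeR R => f (wal b k (x : R))).
Proof.
rewrite (_ : (fun x => _) = (f \o omegaZ) \o
   (fun x : measurableTypeR R => walsh_form k k (digits b (x : R)))); last first.
  by apply/funext => x /=; rewrite (walE _ (leqnn k)).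
apply: measurable_fun_of_digit; have : forall m, measurable_digit (fun x : measurableTypeR R => walsh_form k m (digits b (x : R))); last exact.
elim=> [|m IH].
  by rewrite /walsh_form; under eq_fun do rewrite big_ord0; exact: measurable_digit_cst.
rewrite /walsh_form; under eq_fun do rewrite big_ord_recr /=.
apply: (measurable_digit_op2 (fun u v => u + (nat_digit b k m)%:R * v)) => //.
exact: measurable_digits.
Qed.

End walsh.

(** * The shift and the tent map on the cube *)

Section vectors.
Context (R : realType) (b : nat) (hb : (1 < b)%N) (s : nat).
Local Notation V := (vecR R s).
Local Notation mR := (measurableTypeR R).
Local Notation leb := (@lebesgue_measure R).
Implicit Types (x y sg : V).

(** [vec_shift x sg] is [x (+) sg] and [vec_tent_ext x] is [phi_b x] on the
    cube; both are extended coordinatewise by the identity. *)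
Definition vec_shift x sg : V := vec_map (fun j a => oplus_ext b a (nth 0 sg j)) x.
Definition vec_tent_ext x : V := vec_map (fun _ (a : mR) => tent_ext b (a : R) : mR) x.

Lemma tnth_vec_shift x sg j :
  tnth (vec_shift x sg) j = oplus_ext b (tnth x j) (tnth sg j).
Proof. by rewrite tnth_mktuple -tnth_nth. Qed.

Lemma tnth_vec_tent_ext x j : tnth (vec_tent_ext x) j = tent_ext b (tnth x j).
Proof. by rewrite tnth_mktuple. Qed.

Lemma cubeP x : cube R s x <-> forall j, 0 <= (tnth x j : R) <= 1.
Proof. by split => h j; have := h j; rewrite in_itv. Qed.

Lemma cube_vec_shift x sg : cube R s (vec_shift x sg) <-> cube R s x.
Proof.
by rewrite !cubeP; split => h j; have := h j; rewrite tnth_vec_shift oplus_ext01.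
Qed.

Lemma cube_vec_tent_ext x : cube R s (vec_tent_ext x) <-> cube R s x.
Proof.
by rewrite !cubeP; split => h j; have := h j; rewrite tnth_vec_tent_ext tent_ext01.
Qed.

Lemma vec_oplusE x sg : cube R s x -> cube R s sg -> vec_oplus b x sg = vec_shift x sg.
Proof.
move=> /cubeP cx /cubeP cs; apply: eq_from_tnth => j.
by rewrite tnth_vec_shift tnth_mktuple /oplus_ext cx cs.
Qed.

Lemma vec_oplusC x sg : vec_oplus b x sg = vec_oplus b sg x.
Proof.
apply: eq_from_tnth => j; rewrite !tnth_mktuple /oplus; congr badic_value.
by apply/funext => i; rewrite addrC.
Qed.

Lemma vec_tentE x : cube R s x -> vec_tent b x = vec_tent_ext x.
Proof.
move=> /cubeP cx; apply: eq_from_tnth => j.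
by rewrite tnth_vec_tent_ext tnth_mktuple /tent_ext cx.
Qed.

Lemma measurable_cube : measurable (cube R s).
Proof.
have -> : cube R s = \bigcap_(j in [set: 'I_s])
    ((@tnth _ mR ^~ j) @^-1` [set t : mR | 0 <= (t : R) <= 1]).
  apply/seteqP; split=> x; rewrite cubeP => h j; first by move=> _; exact: h.
  exact: (h j I).
apply: fin_bigcap_measurable => // j _.
rewrite -[X in measurable X]setTI; apply: measurable_tnth => //.
exact: measurable_01.
Qed.

Lemma lebn_cube : lebn R s (cube R s) = 1%E.
Proof.
have -> : cube R s = [set x | forall j : 'I_s, [set t : mR | 0 <= (t : R) <= 1] (tnth x j)].
  by apply/seteqP; split=> x /=; rewrite cubeP.
rewrite (@lebn_box R s (fun=> [set t : mR | 0 <= (t : R) <= 1])); last first.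
  by move=> _; exact: measurable_01.
by apply: big1 => j _; exact: measure01.
Qed.

Lemma preserving_vec_shift sg : cube R s sg -> preserving (lebn R s) (vec_shift^~ sg).
Proof.
move=> /cubeP cs; apply: preserving_vec_map => j.
have c01 : 0 <= (nth 0 sg j : R) <= 1.
  have [js|js] := ltnP j s; last by rewrite nth_default ?size_tuple// lexx ler01.
  by have := cs (Ordinal js); rewrite (tnth_nth 0).
split; last exact: oplus_ext_preserving.
exact: (measurableT_comp (measurable_oplus_ext hb)
  (measurable_fun_pair (@measurable_id _ mR setT) (measurable_cst (nth 0 sg j : mR)))).
Qed.

Lemma preserving_vec_tent_ext : preserving (lebn R s) vec_tent_ext.
Proof.
apply: preserving_vec_map => _; split; first exact: measurable_tent_ext.
exact: tent_ext_preserving.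
Qed.

Lemma measurable_vec_shift :
  measurable_fun setT (fun z : V * V => vec_shift z.1 z.2).
Proof.
apply/measurable_fun_tnthP => j.
rewrite (_ : _ \o _ = (fun p : mR * mR => oplus_ext b p.1 p.2 : mR) \o
    (fun z : V * V => (tnth z.1 j, tnth z.2 j))); last first.
  by apply/funext => z /=; rewrite tnth_vec_shift.
apply: measurableT_comp; first exact: measurable_oplus_ext.
apply: measurable_fun_pair.
  exact: (measurableT_comp (@measurable_tnth _ mR s j) measurable_fst).
exact: (measurableT_comp (@measurable_tnth _ mR s j) measurable_snd).
Qed.

(** Shifting by [sg] adds the digits of [sg] to those of [x], without the
    renormalisation forced by an infinite run of [b - 1]. *)
Definition digits_add x sg := forall (j : 'I_s) i,
  digits b (tnth (vec_shift x sg) j : R) i = digits b (tnth x j : R) i + digits b (tnth sg j : R) i.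

(** Likewise for the digits of the image by the tent map. *)
Definition digits_tent x := forall (j : 'I_s) i,
  digits b (tnth (vec_tent_ext x) j : R) i = digits b (tnth x j : R) i.+1 - digits b (tnth x j : R) 0.

Lemma ae_digits_add sg : cube R s sg ->
  {ae lebn R s, forall x, cube R s x -> digits_add x sg}.
Proof.
move=> /cubeP cs.
have h (j : 'I_s) : {ae lebn R s, forall x : V, 0 <= (tnth x j : R) <= 1 ->
   forall i, digits b (tnth (vec_shift x sg) j : R) i = digits b (tnth x j : R) i + digits b (tnth sg j : R) i}.
  suff : {ae lebn R s, forall x : V, 0 <= (tnth x j : R) <= 1 -> forall i,
      digits b (oplus_ext b (tnth x j) (tnth sg j) : R) i = digits b (tnth x j : R) i + digits b (tnth sg j : R) i}.
    by apply: filterS => x hx x01 i; rewrite tnth_vec_shift; exact: hx.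
  apply: (@ae_lebn_coord _ _ j (fun t : mR => 0 <= (t : R) <= 1 -> forall i,
    digits b (oplus_ext b t (tnth sg j) : R) i = digits b (t : R) i + digits b (tnth sg j : R) i)
    (tail_set (fun i => -1 - digits b (tnth sg j : R) i))).
    exact: countable_tail_set.
  move=> t ht t01 i; rewrite /oplus_ext t01 cs digits_value//; right => n.
  have [m nm hm] := not_tail_set t01 ht n; exists m => // /(eq_inZp_max hb) e.
  by apply: hm; rewrite -e addrK.
apply: (filterS _ (filter_forall _ h)) => x hx /cubeP cx j i.
by apply: hx.
Qed.

Lemma ae_digits_tent : {ae lebn R s, forall x, cube R s x -> digits_tent x}.
Proof.
have h (j : 'I_s) : {ae lebn R s, forall x : V, 0 <= (tnth x j : R) <= 1 ->
   forall i, digits b (tnth (vec_tent_ext x) j : R) i = digits b (tnth x j : R) i.+1 - digits b (tnth x j : R) 0}.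
  suff : {ae lebn R s, forall x : V, 0 <= (tnth x j : R) <= 1 -> forall i,
      digits b (tent_ext b (tnth x j : R) : R) i = digits b (tnth x j : R) i.+1 - digits b (tnth x j : R) 0}.
    by apply: filterS => x hx x01 i; rewrite tnth_vec_tent_ext; exact: hx.
  apply: (@ae_lebn_coord _ _ j (fun t : mR => 0 <= (t : R) <= 1 -> forall i,
    digits b (tent_ext b t : R) i = digits b (t : R) i.+1 - digits b (t : R) 0)
    (\bigcup_(a in [set: 'Z_b]) tail_set (fun=> a))).
    by apply: bigcup_countable => // a _; exact: countable_tail_set.
  move=> t ht t01 i; rewrite /tent_ext t01 digits_value//; right => n.
  apply: contrapT => hn; apply: ht.
  exists (digits b (t : R) 0 - 1) => //; split => //; exists n.+1 => -[//|m]; rewrite ltnS => nm.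
  apply: contrapT => e; apply: hn; exists m => // /(eq_inZp_max hb) e'; apply: e.
  by rewrite addrC -e' subrK.
apply: (filterS _ (filter_forall _ h)) => x hx /cubeP cx j i.
by apply: hx.
Qed.

Lemma vec_wal_shift k x sg : digits_add x sg ->
  vec_wal b k (vec_shift x sg) = vec_wal b k x * vec_wal b k sg.
Proof.
move=> h; rewrite /vec_wal -big_split /=; apply: eq_bigr => j _.
by apply: wal_add => // i; exact: h.
Qed.

(** When [b] divides the sum of the digits of [k], the first digit of [x] drops
    out of [wal_k x], which is thus a Walsh function of the image of [x]. *)
Lemma vec_wal_tent k x : (forall j, (b %| sum_of_digits b (tnth k j))%N) -> digits_tent x ->
  vec_wal b (vec_floor b k) (vec_tent_ext x) = vec_wal b k x.
Proof.
move=> hk h; rewrite /vec_wal; apply: eq_bigr => j _; rewrite tnth_mktuple.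
by apply: wal_tent => // i; exact: h.
Qed.

(** Adding the same value to all digits of a coordinate does not change its
    image under the tent map. *)
Lemma vec_tent_shift x sg : cube R s x -> digits_add x sg ->
  (forall j i, digits b (tnth sg j : R) i = digits b (tnth sg j : R) 0) ->
  vec_tent_ext (vec_shift x sg) = vec_tent_ext x.
Proof.
move=> cx h hc; have cx' : cube R s (vec_shift x sg) by apply/cube_vec_shift.
rewrite -!vec_tentE//; apply: eq_from_tnth => j.
have e y : tnth (vec_tent b y) j = tent b (tnth y j) by rewrite tnth_mktuple.
rewrite !e /tent; congr badic_value.
by apply/funext => i; rewrite !h (hc j i.+1) opprD addrACA subrr addr0.
Qed.

(** The vector equal to [t] at coordinate [j] and to [0] elsewhere. *)
Definition coord_vec (j : 'I_s) (t : R) : V := [tuple (if i == j then t else 0 : mR) | i < s].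

Lemma cube_coord_vec j t : 0 <= t <= 1 -> cube R s (coord_vec j t).
Proof.
by move=> t01; apply/cubeP => i; rewrite tnth_mktuple; case: ifP => // _; rewrite lexx ler01.
Qed.

Lemma digits0 i : digits b (0 : R) i = 0.
Proof.
rewrite digits_lt1 ?lexx ?ltr01// /trunc_digits mul0r.
by apply/val_inj; rewrite /= (_ : Num.truncn 0 = 0%N) ?mod0n//; apply: truncn_def; rewrite lexx ltr01.
Qed.

Lemma wal_at0 k : wal b k (0 : R) = 1.
Proof.
rewrite (walE hb _ (leqnn k)) /walsh_form big1 ?omegaZ0// => i _.
by rewrite digits0 mulr0.
Qed.

Lemma vec_wal_coord_vec k j t : vec_wal b k (coord_vec j t) = wal b (tnth k j) t.
Proof.
rewrite /vec_wal (bigD1 j)//= tnth_mktuple eqxx big1 ?mulr1// => i /negbTE ij.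
by rewrite tnth_mktuple ij wal_at0.
Qed.

Lemma digits_coord_vec_ones (j : 'I_s) i l :
  digits b (tnth (coord_vec j (all_ones R b)) l : R) i =
  digits b (tnth (coord_vec j (all_ones R b)) l : R) 0.
Proof.
by rewrite tnth_mktuple; case: ifP => _; rewrite ?digits0// digits_all_ones.
Qed.

End vectors.

(** * Integrals of complex-valued functions *)

Section complex_integral.
Context (R : realType) d (T : measurableType d).
Implicit Types (f g : T -> R[i]) (h : T -> R).

(** Measurability and integrability of a complex function are those of its real
    and imaginary parts. *)
Definition cmeasurable f :=
  measurable_fun setT (fun x => complex.Re (f x)) /\
  measurable_fun setT (fun x => complex.Im (f x)).

Lemma cmeasurable_cst (c : R[i]) : cmeasurable (fun=> c).
Proof. by split; exact: measurable_cst. Qed.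

Lemma cmeasurableM f g : cmeasurable f -> cmeasurable g -> cmeasurable (fun x => f x * g x).
Proof.
move=> [fr fi] [gr gi]; split.
  rewrite (_ : (fun x => _) = (fun x => complex.Re (f x) * complex.Re (g x)
      - complex.Im (f x) * complex.Im (g x))); last first.
    by apply/funext => x; case: (f x) (g x) => [? ?] [].
  by apply: measurable_funB; apply: measurable_funM.
rewrite (_ : (fun x => _) = (fun x => complex.Re (f x) * complex.Im (g x)
    + complex.Im (f x) * complex.Re (g x))); last first.
  by apply/funext => x; case: (f x) (g x) => [? ?] [].
by apply: measurable_funD; apply: measurable_funM.
Qed.

Lemma cmeasurable_conj f : cmeasurable f -> cmeasurable (fun x => (f x)^*).
Proof.
move=> [fr fi]; split.
  by rewrite (_ : (fun x => _) = (fun x => complex.Re (f x)))//; apply/funext => x; case: (f x).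
rewrite (_ : (fun x => _) = (fun x => - complex.Im (f x))); last first.
  by apply/funext => x; case: (f x).
exact: measurableT_comp.
Qed.

Lemma cmeasurable_prod (I : Type) (r : seq I) (F : I -> T -> R[i]) :
  (forall i, cmeasurable (F i)) -> cmeasurable (fun x => \prod_(i <- r) F i x).
Proof.
move=> mF; elim: r => [|i r IH].
  by under eq_fun do rewrite big_nil; exact: cmeasurable_cst.
by under eq_fun do rewrite big_cons; exact: cmeasurableM.
Qed.

Lemma cmeasurable_real h : measurable_fun setT h -> cmeasurable (fun x => (h x)%:C%C).
Proof. by move=> mh; split => //=; exact: measurable_cst. Qed.

Variable mu : {measure set T -> \bar R}.

Definition cintegrable f :=
  mu.-integrable setT (EFin \o (fun x => complex.Re (f x))) /\
  mu.-integrable setT (EFin \o (fun x => complex.Im (f x))).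

Local Notation CI := (Cintegral mu setT).

Lemma cintegrable_cmeasurable f : cintegrable f -> cmeasurable f.
Proof. by move=> [/integrableP[fr _] /integrableP[fi _]]; split; apply/measurable_EFinP. Qed.

Lemma complex_ReM (a c : R[i]) : complex.Re (a * c) = complex.Re a * complex.Re c - complex.Im a * complex.Im c.
Proof. by case: a c => [? ?] []. Qed.
Lemma complex_ImM (a c : R[i]) : complex.Im (a * c) = complex.Re a * complex.Im c + complex.Im a * complex.Re c.
Proof. by case: a c => [? ?] []. Qed.

Lemma CintegralZ (c : R[i]) f : cintegrable f -> CI (fun x => c * f x) = c * CI f.
Proof.
move=> [fr fi]; rewrite /Cintegral.
have iZ r (h : T -> R) : mu.-integrable setT (EFin \o h) -> mu.-integrable setT (EFin \o (fun x => r * h x)).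
  by move=> ih; have := integrableZl measurableT r ih; exact: eq_integrable.
have -> : \int[mu]_x complex.Re (c * f x) =
    complex.Re c * \int[mu]_x complex.Re (f x) - complex.Im c * \int[mu]_x complex.Im (f x).
  rewrite -!RintegralZl// -RintegralB//; [|exact: iZ|exact: iZ].
  by apply: eq_Rintegral => x _; rewrite complex_ReM.
have -> : \int[mu]_x complex.Im (c * f x) =
    complex.Re c * \int[mu]_x complex.Im (f x) + complex.Im c * \int[mu]_x complex.Re (f x).
  rewrite -!RintegralZl// -RintegralD//; [|exact: iZ|exact: iZ].
  by apply: eq_Rintegral => x _; rewrite complex_ImM.
by apply/eqP; rewrite eq_complex complex_ReM complex_ImM /= !eqxx.
Qed.

Lemma Cintegral_preserving (t : T -> T) f : preserving mu t -> cintegrable f ->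
  CI (fun x => f (t x)) = CI f.
Proof.
move=> pt [fr fi]; rewrite /Cintegral /Rintegral.
by rewrite (integral_preserving pt fr) (integral_preserving pt fi).
Qed.

Lemma cintegrable_preserving (t : T -> T) f : preserving mu t -> cintegrable f ->
  cintegrable (fun x => f (t x)).
Proof.
by move=> pt [fr fi]; split; [exact: (integrable_preserving pt fr)|exact: (integrable_preserving pt fi)].
Qed.

Lemma ae_eq_Cintegral f g : cmeasurable f -> cmeasurable g ->
  {ae mu, forall x, f x = g x} -> CI f = CI g.
Proof.
move=> [fr fi] [gr gi] fg; rewrite /Cintegral /Rintegral.
congr ((fine _) +i* (fine _))%C; apply: ae_eq_integral => //;
  try by apply/measurable_EFinP.
  by apply: filterS fg => x -> _.
by apply: filterS fg => x -> _.
Qed.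

(** A function whose integral is multiplied by [c != 1] under a change of
    variables that preserves the measure has integral zero. *)
Lemma Cintegral_eq0 (t : T -> T) (c : R[i]) f : preserving mu t -> cintegrable f ->
  c != 1 -> {ae mu, forall x, f (t x) = c * f x} -> CI f = 0.
Proof.
move=> pt ft c1 h.
have e : CI f = c * CI f.
  rewrite -[LHS](Cintegral_preserving pt ft) -CintegralZ//; apply: ae_eq_Cintegral => //.
    exact/cintegrable_cmeasurable/cintegrable_preserving.
  by apply: cmeasurableM; [exact: cmeasurable_cst|exact: cintegrable_cmeasurable].
have : (1 - c) * CI f = 0 by rewrite mulrBl mul1r -e subrr.
by move=> /eqP; rewrite mulf_eq0 subr_eq0 eq_sym (negbTE c1) => /eqP.
Qed.

Lemma unimodular_le1 (z : R[i]) : z * z^* = 1 -> `|complex.Re z| <= 1 /\ `|complex.Im z| <= 1.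
Proof.
case: z => x y /(congr1 (@complex.Re R)); rewrite complex_ReM /= => h.
have x2 := sqr_ge0 x; have y2 := sqr_ge0 y.
by split; rewrite -[X in _ <= X]normr1 -ler_sqr ?qualifE/= ?normr_ge0// !real_normK ?num_real// ?expr1n; lra.
Qed.

Lemma cintegrable_unimodular h g : mu.-integrable setT (EFin \o h) -> cmeasurable g ->
  (forall x, g x * (g x)^* = 1) -> cintegrable (fun x => (h x)%:C%C * g x).
Proof.
move=> ih mg g1; have [mgr mgi] := mg.
have mh : measurable_fun setT h by case/integrableP: ih => /measurable_EFinP.
split; apply: (le_integrable measurableT _ _ ih).
- apply/measurable_EFinP; have [] // := cmeasurableM (cmeasurable_real mh) mg.
- move=> x _ /=; rewrite complex_ReM /= mul0r subr0 lee_fin normrM ler_piMr//.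
  by have [] := unimodular_le1 (g1 x).
- apply/measurable_EFinP; have [] // := cmeasurableM (cmeasurable_real mh) mg.
- move=> x _ /=; rewrite complex_ImM /= mul0r addr0 lee_fin normrM ler_piMr//.
  by have [] := unimodular_le1 (g1 x).
Qed.

End complex_integral.

(** * Walsh coefficients of the folded digitally shifted kernel *)

(** As [oo - oo] is infinite, an integral with a finite value exists. *)
Lemma integrable_of_fin_num_integral (R : realType) d (T : measurableType d)
    (mu : {measure set T -> \bar R}) (D : set T) (f : T -> \bar R) :
  measurable D -> measurable_fun D f ->
  (\int[mu]_(x in D) f x)%E \is a fin_num -> mu.-integrable D f.
Proof.
move=> mD mf; rewrite integralE => fin; apply/integrableP; split => //.
have p0 : (0 <= \int[mu]_(x in D) f^\+ x)%E by apply: integral_ge0.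
have n0 : (0 <= \int[mu]_(x in D) f^\- x)%E by apply: integral_ge0.
under eq_integral do rewrite -/((abse \o f) _) fune_abse.
rewrite ge0_integralD//; [|exact: measurable_funepos|exact: measurable_funeneg].
move: fin p0 n0.
case: (\int[mu]_(x in D) f^\+ x)%E => [p| |]//; case: (\int[mu]_(x in D) f^\- x)%E => [q| |]//=.
by rewrite -EFinD ltry.
Qed.

Section walsh_coef.
Context (R : realType) (b : nat) (hb : (1 < b)%N) (s : nat).
Local Notation V := (vecR R s).
Local Notation cub := (cube R s).
Local Notation mu := (lebn R s).
Local Notation mu2 := (leb2 R s).

Lemma cmeasurable_vec_wal k : cmeasurable (fun x : V => vec_wal b k x).
Proof.
apply: cmeasurable_prod => j; split.
  exact: (measurableT_comp (measurable_wal hb (tnth k j) (@complex.Re R)) (measurable_tnth j)).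
exact: (measurableT_comp (measurable_wal hb (tnth k j) (@complex.Im R)) (measurable_tnth j)).
Qed.

(** The kernel [conj (wal_k x) * wal_l y] defining the Walsh coefficients. *)
Definition walsh_pair (k l : s.-tuple nat) (z : V * V) : R[i] :=
  (vec_wal b k z.1)^* * vec_wal b l z.2.

Lemma cmeasurable_walsh_pair k l : cmeasurable (walsh_pair k l).
Proof.
have h d (T : measurableType d) (f : T -> V) : measurable_fun setT f -> forall k,
    cmeasurable (fun x => vec_wal b k (f x)).
  by move=> mf k0; have [mr mi] := cmeasurable_vec_wal k0; split; [exact: (measurableT_comp mr mf)|exact: (measurableT_comp mi mf)].
by apply: cmeasurableM; [apply: cmeasurable_conj|]; apply: h.
Qed.

Lemma walsh_pair_unimodular k l z : walsh_pair k l z * (walsh_pair k l z)^* = 1.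
Proof.
rewrite /walsh_pair rmorphM /= conjCK mulrACA.
by rewrite [X in X * _]mulrC !(vec_wal_conj hb) mulr1.
Qed.

Lemma walsh_pair_shift k l (x y sx sy : V) :
  digits_add b x sx -> digits_add b y sy ->
  walsh_pair k l (vec_shift b x sx, vec_shift b y sy) =
  walsh_pair k l (sx, sy) * walsh_pair k l (x, y).
Proof.
move=> hx hy; rewrite /walsh_pair /= !(vec_wal_shift hb)// rmorphM /=.
by rewrite mulrACA mulrC.
Qed.

Variable K : V -> V -> R.
Hypothesis KL2 : square_integrable K.

(** The kernel extended by zero outside of the cube. *)
Definition ext_kernel (z : V * V) : R := ((fun z => K z.1 z.2) \_ (cub `*` cub)) z.
Local Notation K0 := ext_kernel.

Lemma ext_kernelE x y : cub x -> cub y -> K0 (x, y) = K x y.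
Proof. by move=> cx cy; rewrite /K0 patchE mem_set. Qed.

Lemma ext_kernel_out z : ~ (cub `*` cub) z -> K0 z = 0.
Proof. by move=> h; rewrite /K0 patchE memNset. Qed.

Lemma measurable_cube2 : measurable (cub `*` cub).
Proof. by apply: measurableX; exact: measurable_cube. Qed.

Lemma measurable_ext_kernel : measurable_fun setT K0.
Proof. by have /sub_Lfun_mfun := KL2; rewrite inE. Qed.

Lemma leb2_cube2 : mu2 (cub `*` cub) = 1%E.
Proof.
have mc := @measurable_cube R s.
rewrite [LHS](product_measure1E _ _ mc mc).
by rewrite [X in (X * _)%E]lebn_cube [X in (_ * X)%E]lebn_cube mule1.
Qed.

Lemma integrable_ext_kernel : mu2.-integrable setT (EFin \o K0).
Proof.
have i1 : mu2.-integrable setT (EFin \o (fun z : V * V => \1_(cub `*` cub) z + K0 z ^+ 2)).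
  apply: (@eq_integrable _ _ _ _ _ measurableT ((EFin \o \1_(cub `*` cub)) \+ (EFin \o (fun z => (K0 z ^+ 2)%R)))%E).
    by move=> z _; rewrite /= EFinD.
  apply: integrableD => //; last exact: (Lfun2_integrable_sqr KL2).
  apply/integrableP; split.
    by apply/measurable_EFinP; apply: measurable_indic; exact: measurable_cube2.
  under eq_integral do rewrite /= ger0_norm//.
  rewrite integral_indic ?setIT ?leb2_cube2 ?ltry//; exact: measurable_cube2.
apply: (le_integrable measurableT _ _ i1).
  by apply/measurable_EFinP; exact: measurable_ext_kernel.
move=> z _; rewrite /= lee_fin [leRHS]ger0_norm ?addr_ge0 ?sqr_ge0//.
rewrite indicE; have [cz|cz] := pselect ((cub `*` cub) z); last first.
  by rewrite ext_kernel_out// normr0 addr_ge0 ?sqr_ge0.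
rewrite mem_set//= -[K0 z ^+ 2]real_normK ?num_real//.
(* [t <= 1 + t ^ 2] *)
have := sqr_ge0 (`|K0 z| - 1); have := normr_ge0 (K0 z); nra.
Qed.

Lemma walsh_coefE k l :
  walsh_coef b K k l = Cintegral mu2 setT (fun z => (K0 z)%:C%C * walsh_pair k l z).
Proof.
rewrite /walsh_coef /Cintegral; congr (_ +i* _)%C.
  rewrite Rintegral_mkcond; apply: eq_Rintegral => z _.
  rewrite /K0 !patchE; case: ifPn => _; first by rewrite -mulrA.
  by rewrite -[point]/(0 : R) complex_ReM /= !mul0r subrr.
rewrite Rintegral_mkcond; apply: eq_Rintegral => z _.
rewrite /K0 !patchE; case: ifPn => _; first by rewrite -mulrA.
by rewrite -[point]/(0 : R) complex_ImM /= !mul0r addr0.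
Qed.

(** The tent map and the shift by a common vector, applied to both arguments. *)
Definition pair_tent (z : V * V) : V * V := (vec_tent_ext b z.1, vec_tent_ext b z.2).
Definition pair_shift (sg : V) (z : V * V) : V * V := (vec_shift b z.1 sg, vec_shift b z.2 sg).

Lemma preserving_pair_tent : preserving mu2 pair_tent.
Proof. by apply: preserving_prod; exact: preserving_vec_tent_ext. Qed.

Lemma preserving_pair_shift sg : cub sg -> preserving mu2 (pair_shift sg).
Proof. by move=> cs; apply: preserving_prod; exact: preserving_vec_shift. Qed.

Lemma pair_tent_cube z : (cub `*` cub) (pair_tent z) <-> (cub `*` cub) z.
Proof. by rewrite /setX /= !cube_vec_tent_ext. Qed.

Lemma pair_shift_cube sg z : (cub `*` cub) (pair_shift sg z) <-> (cub `*` cub) z.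
Proof. by rewrite /setX /= !cube_vec_shift. Qed.

Lemma cintegrable_kernel (h : V * V -> R) k l : mu2.-integrable setT (EFin \o h) ->
  cintegrable mu2 (fun z => (h z)%:C%C * walsh_pair k l z).
Proof.
move=> ih; apply: cintegrable_unimodular => //; first exact: cmeasurable_walsh_pair.
exact: walsh_pair_unimodular.
Qed.

(** The kernel [K (phi_b x, phi_b y)]. *)
Definition folded_kernel (z : V * V) : R := K0 (pair_tent z).

Lemma integrable_folded_kernel : mu2.-integrable setT (EFin \o folded_kernel).
Proof. exact: (integrable_preserving preserving_pair_tent integrable_ext_kernel). Qed.

Lemma folded_kernel_out z : ~ (cub `*` cub) z -> folded_kernel z = 0.
Proof. by move=> h; apply: ext_kernel_out => /pair_tent_cube. Qed.

Lemma ae_leb2 (P : V -> Prop) : {ae mu, forall x, cub x -> P x} ->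
  {ae mu2, forall z, (cub `*` cub) z -> P z.1 /\ P z.2}.
Proof.
move=> h; have h1 : {ae mu2, forall z, cub z.1 -> P z.1} by exact: ae_prod_fst h.
have h2 : {ae mu2, forall z, cub z.2 -> P z.2} by exact: ae_prod_snd h.
by apply: filterS2 h1 h2 => z hz1 hz2 [/hz1 ? /hz2 ?].
Qed.

(** The condition that [k] has all its components in [E_b] or equal to zero. *)
Definition digit_sums_dvd (k : s.-tuple nat) := forall j, (b %| sum_of_digits b (tnth k j))%N.

Local Notation fcoef k l := (Cintegral mu2 setT (fun z => (folded_kernel z)%:C%C * walsh_pair k l z)).

Lemma folded_coefE k l : digit_sums_dvd k -> digit_sums_dvd l ->
  fcoef k l = walsh_coef b K (vec_floor b k) (vec_floor b l).
Proof.
move=> hk hl; rewrite walsh_coefE.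
have ci := cintegrable_kernel (vec_floor b k) (vec_floor b l) integrable_ext_kernel.
rewrite -(Cintegral_preserving preserving_pair_tent ci); apply: ae_eq_Cintegral.
- exact/cintegrable_cmeasurable/cintegrable_kernel/integrable_folded_kernel.
- exact: (cintegrable_cmeasurable (cintegrable_preserving preserving_pair_tent ci)).
apply: filterS (ae_leb2 (ae_digits_tent R hb s)) => z hz.
have [cz|cz] := pselect ((cub `*` cub) z); last first.
  by rewrite folded_kernel_out// ext_kernel_out ?mul0r// => /pair_tent_cube.
have [h1 h2] := hz cz.
by rewrite /walsh_pair /= !vec_wal_tent.
Qed.

Lemma folded_coef0 k l : ~ digit_sums_dvd k -> fcoef k l = 0.
Proof.
move=> /existsNP[j hj].
pose tau := coord_vec j (all_ones R b).
have ctau : cub tau by apply: cube_coord_vec; exact: badic_value01.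
pose T z : V * V := (vec_shift b z.1 tau, z.2).
have pT : preserving mu2 T.
  exact: (preserving_prod (preserving_vec_shift hb ctau) (preserving_id mu)).
apply: (@Cintegral_eq0 _ _ _ _ T ((vec_wal b k tau)^*)) => //.
- exact/cintegrable_kernel/integrable_folded_kernel.
- rewrite (vec_wal_coord_vec hb) wal_all_ones//; apply/eqP => e; apply: hj.
  rewrite (dvdn_natr_Zp hb); apply/eqP; apply: (omegaZ_eq1 (R := R) hb).
  by rewrite -[LHS]conjCK e rmorph1.
apply: filterS (ae_prod_fst mu (ae_digits_add hb ctau)) => z hz.
have Tz : (cub `*` cub) (T z) <-> (cub `*` cub) z by rewrite /setX /= cube_vec_shift.
have [cz|cz] := pselect ((cub `*` cub) z); last first.
  by rewrite !folded_kernel_out ?mul0r ?mulr0// => /Tz.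
have h := hz cz.1.
have -> : folded_kernel (T z) = folded_kernel z.
  congr (K0 _); rewrite /pair_tent /T /=; congr pair.
  by apply: vec_tent_shift => //; [exact: cz.1|move=> j0 i; exact: digits_coord_vec_ones].
by rewrite /walsh_pair /= (vec_wal_shift hb)// rmorphM /=; ring.
Qed.

End walsh_coef.

Section product_sigma_finite.
Context (R : realType) d1 d2 (T1 : measurableType d1) (T2 : measurableType d2).
Variables (m1 : {sigma_finite_measure set T1 -> \bar R})
          (m2 : {sigma_finite_measure set T2 -> \bar R}).

Lemma product_sigma_finite : sigma_finite setT (m1 \x m2)%E.
Proof.
have /sigma_finiteP[F [TF ndF Foo]] := sigma_finiteT m1.
have /sigma_finiteP[G [TG ndG Goo]] := sigma_finiteT m2.
exists (fun n => F n `*` G n).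
  rewrite -setXTT TF TG predeqE => -[x y]; split.
    move=> [/= [n _ Fnx] [k _ Gky]]; exists (maxn n k) => //; split.
    - by move: x Fnx; exact/subsetPset/ndF/leq_maxl.
    - by move: y Gky; exact/subsetPset/ndG/leq_maxr.
  by move=> [n _ []/= ? ?]; split; exists n.
move=> k; have [? ?] := Foo k; have [? ?] := Goo k.
split; first exact: measurableX.
by rewrite product_measure1E// lte_mul_pinfty// ge0_fin_numE.
Qed.

(** The product measure, packed with its sigma-finiteness. *)
Definition sf_product_measure : {sigma_finite_measure set (T1 * T2)%type -> \bar R} :=
  let mixin := @Measure_isSigmaFinite.Build _ _ R (m1 \x m2)%E product_sigma_finite in
  HB.pack (m1 \x m2)%E mixin.

End product_sigma_finite.

Section shifted_coef.
Context (R : realType) (b : nat) (hb : (1 < b)%N) (s : nat).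
Local Notation V := (vecR R s).
Local Notation cub := (cube R s).
Local Notation mu := (lebn R s).
Local Notation mu2 := (leb2 R s).
Variable K : V -> V -> R.
Hypothesis KL2 : square_integrable K.
Hypothesis Ksh_fin : forall x y, cub x -> cub y -> shifted_kernel b K x y \is a fin_num.
Local Notation G := (folded_kernel b K).
Local Notation S := (@pair_shift R b s).
Local Notation Ksh := (fun x y => fine (shifted_kernel b K x y)).
Local Notation fcoef k l := (Cintegral mu2 setT (fun z => (G z)%:C%C * walsh_pair b k l z)).

Lemma shifted_kernelE x y : cub x -> cub y ->
  shifted_kernel b K x y = (\int[mu]_(sg in cub) (G (S sg (x, y)))%:E)%E.
Proof.
move=> cx cy; apply: eq_integral => sg; rewrite inE => cs.
have cx' : cub (vec_shift b x sg) by apply/cube_vec_shift.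
have cy' : cub (vec_shift b y sg) by apply/cube_vec_shift.
rewrite /folded_kernel /pair_tent /pair_shift /= ext_kernelE ?cube_vec_tent_ext//.
by rewrite !vec_oplusE// !vec_tentE.
Qed.

Lemma measurable_shifted_folded :
  measurable_fun setT (fun p : (V * V) * V => G (S p.2 p.1)).
Proof.
have mt : measurable_fun setT (@vec_tent_ext R b s) by case: (preserving_vec_tent_ext R hb s).
have mG : measurable_fun setT G.
  by case/integrableP: (integrable_folded_kernel hb KL2) => /measurable_EFinP.
apply: (measurableT_comp mG).
have h (f : V * V -> V) : measurable_fun setT f ->
    measurable_fun setT (fun p : (V * V) * V => vec_shift b (f p.1) p.2).
  move=> mf; exact: (measurableT_comp (measurable_vec_shift hb (s := s))
    (measurable_fun_pair (measurableT_comp mf measurable_fst) measurable_snd)).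
by apply: measurable_fun_pair; [exact: (h _ measurable_fst)|exact: (h _ measurable_snd)].
Qed.

Lemma integrable_shifted_folded x y : cub x -> cub y ->
  mu.-integrable cub (fun sg => (G (S sg (x, y)))%:E).
Proof.
move=> cx cy; apply: integrable_of_fin_num_integral; first exact: measurable_cube.
  apply/measurable_EFinP; apply: (measurable_funS measurableT) => //.
  have mp : measurable_fun setT (fun sg : V => ((x, y), sg) : (V * V) * V).
    by apply: measurable_fun_pair => //; exact: measurable_cst.
  exact: (measurableT_comp measurable_shifted_folded mp).
by rewrite -shifted_kernelE// Ksh_fin.
Qed.

(** The integral of [wal_k * conj (wal_l)] over the cube. *)
Definition shift_coef (k l : s.-tuple nat) : R[i] :=
  Cintegral mu setT (fun sg => (\1_cub sg)%:C%C * (walsh_pair b k l (sg, sg))^*).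

Lemma cintegrable_shift_coef k l :
  cintegrable mu (fun sg => (\1_cub sg)%:C%C * (walsh_pair b k l (sg, sg))^*).
Proof.
have mc := @measurable_cube R s.
apply: cintegrable_unimodular.
- apply/integrableP; split.
    by apply/measurable_EFinP; exact: measurable_indic.
  under eq_integral do rewrite /= ger0_norm//.
  by rewrite integral_indic// setIT [ltLHS]lebn_cube ltry.
- apply: cmeasurable_conj; apply: cmeasurableM.
    by apply: cmeasurable_conj; exact: cmeasurable_vec_wal.
  exact: cmeasurable_vec_wal.
- by move=> sg; rewrite conjCK mulrC walsh_pair_unimodular.
Qed.

Lemma shift_coef_diag k : shift_coef k k = 1.
Proof.
rewrite /shift_coef /Cintegral.
have e sg : (walsh_pair b k k (sg, sg))^* = 1.
  by rewrite /walsh_pair mulrC vec_wal_conj// rmorph1.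
have mc := @measurable_cube R s.
have -> : \int[mu]_sg complex.Re ((\1_cub sg)%:C%C * (walsh_pair b k k (sg, sg))^*) = 1.
  under eq_Rintegral do rewrite e mulr1 /=.
  by rewrite /Rintegral integral_indic// setIT [X in fine X]lebn_cube.
have -> // : \int[mu]_sg complex.Im ((\1_cub sg)%:C%C * (walsh_pair b k k (sg, sg))^*) = 0.
by under eq_Rintegral do rewrite e mulr1 /=; rewrite /Rintegral integral0.
Qed.

Lemma shift_coef_neq k l : k != l -> shift_coef k l = 0.
Proof.
move=> kl.
(* shift by one unit at a digit where [k] and [l] differ *)
have [j [i hji]] : exists j i, nat_digit b (tnth k j) i <> nat_digit b (tnth l j) i.
  apply: contrapT => h; move: kl => /eqP; apply; apply: eq_from_tnth => j.
  apply: (nat_digit_inj hb) => i; apply: contrapT => hh; apply: h; by exists j, i.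
pose tau := coord_vec j (unit_shift R b i).
have ctau : cub tau by apply: cube_coord_vec; exact: badic_value01.
have mc := @measurable_cube R s.
rewrite /shift_coef; apply: (@Cintegral_eq0 R _ V mu (fun x => vec_shift b x tau) ((walsh_pair b k l (tau, tau))^*)
  (fun sg => (\1_cub sg)%:C%C * (walsh_pair b k l (sg, sg))^*)).
- exact: preserving_vec_shift.
- exact: cintegrable_shift_coef.
- apply/eqP => /(congr1 Num.conj); rewrite conjCK rmorph1.
  rewrite /walsh_pair /= !(vec_wal_coord_vec hb) !wal_unit_shift//.
  move=> e; apply: hji; apply: (natr_Zp_inj hb); rewrite ?ltn_mod ?(ltnW hb)//.
  apply: (omegaZ_inj (R := R) hb); by rewrite -[LHS]mulr1 -e mulrA omegaZ_conj mul1r.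
apply: filterS (ae_digits_add hb ctau) => sg hsg.
have [cs|cs] := pselect (cub sg); last first.
  have cs' : ~ cub (vec_shift b sg tau) by rewrite cube_vec_shift.
  by rewrite !indicE !memNset// !mul0r mulr0.
have cs' : cub (vec_shift b sg tau) by apply/cube_vec_shift.
rewrite !indicE !mem_set// !mul1r.
by rewrite (walsh_pair_shift hb _ _ (hsg cs) (hsg cs)) rmorphM.
Qed.

Let mu2s := sf_product_measure mu mu.

(** The function to which Fubini's theorem is applied, of the arguments of the
    kernel and of the shift. *)
Let F (W : V * V -> R) (p : (V * V) * V) : R := \1_cub p.2 * (G (S p.2 p.1) * W p.1).

Lemma integrable_shifted_product (W : V * V -> R) : measurable_fun setT W ->
  (forall z, `|W z| <= 1) -> (mu2s \x mu)%E.-integrable setT (EFin \o F W).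
Proof.
move=> mW W1.
have mc := @measurable_cube R s.
have mF : measurable_fun setT (F W).
  apply: measurable_funM; first exact: (measurableT_comp (measurable_indic mc) measurable_snd).
  apply: measurable_funM; first exact: measurable_shifted_folded.
  exact: (measurableT_comp mW measurable_fst).
have /integrableP[mG Goo] := integrable_folded_kernel hb KL2.
have mEF : measurable_fun setT (EFin \o F W) by exact/measurable_EFinP.
apply: (proj2 (@integrable21ltyP _ _ _ _ R mu2s mu _ mEF)).
apply: (@le_lt_trans _ _ (\int[mu]_(sg in cub) (\int[mu2]_z `|(EFin \o G) z|))%E); last first.
  rewrite integral_cst//= [X in (_ * X)%E]lebn_cube mule1; exact: Goo.
rewrite [leRHS]integral_mkcond; apply: ge0_le_integral => //.
- by move=> sg _; exact: integral_ge0.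
- apply: (measurable_fun_fubini_tonelli_G (fun p => `|(EFin \o F W) p|%E)) => //.
  by apply: measurableT_comp => //; exact/measurable_EFinP.
- apply: (proj1 (measurable_restrictT _ mc)); exact: measurable_cst.
move=> sg _; rewrite patchE; case: ifPn => cs; last first.
  rewrite integral0_eq// => z _.
  by rewrite /= /F indicE /= (negbTE cs) mul0r normr0.
rewrite inE in cs.
rewrite -[leRHS](ge0_integral_preserving (preserving_pair_shift hb cs) (g := fun z => `|(EFin \o G) z|%E))//; last first.
  by apply: measurableT_comp.
apply: ge0_le_integral => //.
- apply: measurableT_comp => //; apply/measurable_EFinP.
  have mp : measurable_fun setT (fun z : V * V => (z, sg) : (V * V) * V).
    by apply: measurable_fun_pair => //; exact: measurable_cst.
  exact: (measurableT_comp mF mp).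
- have [mS _] := preserving_pair_shift hb cs.
  apply: measurableT_comp => //; exact: (measurableT_comp mG mS).
- move=> z _; rewrite /= lee_fin /F indicE mem_set// mul1r normrM.
  by rewrite ler_piMr.
Qed.

Lemma integral_shifted_kernel (W : V * V -> R) : measurable_fun setT W ->
  (forall z, `|W z| <= 1) ->
  \int[mu2]_(z in cub `*` cub) (Ksh z.1 z.2 * W z) =
  \int[mu]_(sg in cub) \int[mu2]_z (G (S sg z) * W z).
Proof.
move=> mW W1; have iF := integrable_shifted_product mW W1.
have mc := @measurable_cube R s.
have FI : (\int[mu2]_z \int[mu]_sg (F W (z, sg))%:E = \int[mu]_sg \int[mu2]_z (F W (z, sg))%:E)%E.
  exact: (Fubini iF).
have L : (\int[mu2]_(z in cub `*` cub) (Ksh z.1 z.2 * W z)%:E = \int[mu2]_z \int[mu]_sg (F W (z, sg))%:E)%E.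
  rewrite integral_mkcond; apply: eq_integral => z _; rewrite patchE; case: ifPn => cz; last first.
    rewrite integral0_eq// => sg _.
    rewrite /F folded_kernel_out ?mul0r ?mulr0// => /(pair_shift_cube hb).
    by move: cz; rewrite notin_setE.
  move: cz; rewrite inE; case: z => x y [/= cx cy].
  transitivity (\int[mu]_(sg in cub) ((G (S sg (x, y)))%:E * (W (x, y))%:E))%E.
    rewrite integralZr//; last exact: integrable_shifted_folded.
    by rewrite -shifted_kernelE// EFinM fineK// Ksh_fin.
  rewrite integral_mkcond; apply: eq_integral => sg _; rewrite /F patchE indicE /=.
  by case: ifP => _ /=; rewrite ?mul1r ?mul0r.
rewrite /Rintegral L FI [in RHS]integral_mkcond; congr fine; apply: eq_integral => sg _.
rewrite patchE; case: ifPn => cs; last first.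
  by rewrite integral0_eq// => z _; rewrite /F indicE /= (negbTE cs) mul0r.
have cs' : cub sg by rewrite inE in cs.
rewrite /F /= indicE cs; under eq_integral do rewrite mul1r.
rewrite fineK//; apply: integrable_fin_num => //.
apply: (le_integrable measurableT _ _ (integrable_preserving (preserving_pair_shift hb cs') (integrable_folded_kernel hb KL2))).
  apply/measurable_EFinP; apply: measurable_funM => //.
  have [mS _] := preserving_pair_shift hb cs'.
  have mG : measurable_fun setT G.
    by case/integrableP: (integrable_folded_kernel hb KL2) => /measurable_EFinP.
  exact: (measurableT_comp mG mS).
by move=> z _; rewrite /= lee_fin normrM ler_piMr.
Qed.

Lemma Cintegral_shifted k l sg : cub sg ->
  Cintegral mu2 setT (fun z => (G (S sg z))%:C%C * walsh_pair b k l z) =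
  fcoef k l * (walsh_pair b k l (sg, sg))^*.
Proof.
move=> cs; have pS := preserving_pair_shift hb cs.
have ci := cintegrable_kernel hb k l (integrable_folded_kernel hb KL2).
rewrite mulrC -(Cintegral_preserving pS ci) -CintegralZ; last exact: cintegrable_preserving pS ci.
apply: ae_eq_Cintegral.
- apply: cintegrable_cmeasurable; apply: (cintegrable_kernel hb).
  exact: (integrable_preserving pS (integrable_folded_kernel hb KL2)).
- apply: cmeasurableM; first exact: cmeasurable_cst.
  exact: (cintegrable_cmeasurable (cintegrable_preserving pS ci)).
apply: filterS (ae_leb2 (ae_digits_add hb cs)) => z hz.
have [cz|cz] := pselect ((cub `*` cub) z); last first.
  by rewrite folded_kernel_out ?mul0r ?mulr0// => /(pair_shift_cube hb).
have [h1 h2] := hz cz.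
rewrite [walsh_pair b k l (S sg z)](walsh_pair_shift hb _ _ h1 h2).
rewrite -surjective_pairing.
move: (walsh_pair b k l z) (walsh_pair b k l (sg, sg)) (walsh_pair_unimodular hb k l (sg, sg)).
move=> v u hu; transitivity ((u * u^*) * ((G (S sg z))%:C%C * v)); first by rewrite hu mul1r.
by rewrite [u * _]mulrC -mulrA; congr (_ * _); rewrite mulrCA.
Qed.

(** The shift separates from the arguments of the kernel. *)
Lemma walsh_coef_shifted k l :
  walsh_coef b Ksh k l = fcoef k l * shift_coef k l.
Proof.
have [mr mi] := cmeasurable_walsh_pair R hb k l.
have leW (z : V * V) := unimodular_le1 (walsh_pair_unimodular hb k l z).
rewrite /shift_coef -CintegralZ; last exact: cintegrable_shift_coef.
rewrite /walsh_coef /Cintegral; congr (_ +i* _)%C.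
  transitivity (\int[mu2]_(z in cub `*` cub) (Ksh z.1 z.2 * complex.Re (walsh_pair b k l z))).
    by apply: eq_Rintegral => z _; rewrite -mulrA complex_ReM /= mul0r subr0.
  rewrite integral_shifted_kernel// => [|z]; last by case: (leW z).
  rewrite Rintegral_mkcond; apply: eq_Rintegral => sg _; rewrite patchE indicE.
  case: ifPn => cs; last by rewrite mul0r mulr0.
  have := congr1 (@complex.Re R) (Cintegral_shifted k l (set_mem cs)).
  rewrite mul1r => <-; apply: eq_Rintegral => z _.
  by rewrite [RHS]complex_ReM /= mul0r subr0.
transitivity (\int[mu2]_(z in cub `*` cub) (Ksh z.1 z.2 * complex.Im (walsh_pair b k l z))).
  by apply: eq_Rintegral => z _; rewrite -mulrA complex_ImM /= mul0r addr0.
rewrite integral_shifted_kernel// => [|z]; last by case: (leW z).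
rewrite Rintegral_mkcond; apply: eq_Rintegral => sg _; rewrite patchE indicE.
case: ifPn => cs; last by rewrite mul0r mulr0.
have := congr1 (@complex.Im R) (Cintegral_shifted k l (set_mem cs)).
rewrite mul1r => <-; apply: eq_Rintegral => z _.
by rewrite [RHS]complex_ImM /= mul0r addr0.
Qed.

(** The Walsh coefficients of the folded shifted kernel. *)
Lemma walsh_coef_shifted_kernel k l :
  walsh_coef b Ksh k l =
  if (k == l) && `[< digit_sums_dvd b k >]
  then walsh_coef b K (vec_floor b k) (vec_floor b k) else 0.
Proof.
rewrite walsh_coef_shifted; have [<-|kl] := eqVneq k l; last by rewrite shift_coef_neq ?mulr0.
rewrite shift_coef_diag mulr1 /=; case: asboolP => h; first exact (folded_coefE hb KL2 h h).
exact: (folded_coef0 hb KL2 k h).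
Qed.

End shifted_coef.

(** * Riesz representation in a Hilbert space of functions *)

Section hilbert.
Context (R : realType) (T : Type) (D : set T) (H : hilbert_fun_space R D).
Local Notation ip := (@inner R T D H).
Implicit Types f g h : H.

Lemma innerDl f g h : ip (f + g) h = ip f h + ip g h.
Proof. by rewrite -[in LHS](scale1r f) inner_linear mul1r. Qed.

Lemma inner0l h : ip 0 h = 0.
Proof. by apply: (addrI (ip 0 h)); rewrite -innerDl !addr0. Qed.

Lemma innerZl a f h : ip (a *: f) h = a * ip f h.
Proof. by rewrite -[in LHS](addr0 (a *: f)) inner_linear inner0l addr0. Qed.

Lemma innerNl f h : ip (- f) h = - ip f h.
Proof. by rewrite -scaleN1r innerZl mulN1r. Qed.

Lemma innerBl f g h : ip (f - g) h = ip f h - ip g h.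
Proof. by rewrite innerDl innerNl. Qed.

Lemma innerDr f g h : ip h (f + g) = ip h f + ip h g.
Proof. by rewrite ![ip h _]innerC innerDl. Qed.

Lemma innerZr a f h : ip h (a *: f) = a * ip h f.
Proof. by rewrite ![ip h _]innerC innerZl. Qed.

Lemma innerBr f g h : ip h (f - g) = ip h f - ip h g.
Proof. by rewrite ![ip h _]innerC innerBl. Qed.

Lemma inner_sumr (I : Type) (r : seq I) (F : I -> H) h :
  ip h (\sum_(i <- r) F i) = \sum_(i <- r) ip h (F i).
Proof.
elim: r => [|i r IH]; first by rewrite !big_nil innerC inner0l.
by rewrite !big_cons innerDr IH.
Qed.

Lemma normD_sqr f g : `|f + g| ^+ 2 = `|f| ^+ 2 + 2 * ip f g + `|g| ^+ 2.
Proof.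
by rewrite -!inner_norm innerDl !innerDr (innerC g f); ring.
Qed.

Lemma cauchy_schwarz f g : `|ip f g| <= `|f| * `|g|.
Proof.
have [g0|g0] := eqVneq (`|g|) 0.
  have -> : g = 0 by apply/eqP; rewrite -normr_eq0 g0.
  by rewrite innerC inner0l !normr0 mulr0.
have gp : 0 < `|g| by rewrite lt_neqAle eq_sym g0 normr_ge0.
have : 0 <= `|f + (- (ip f g / `|g| ^+ 2)) *: g| ^+ 2 by exact: sqr_ge0.
rewrite normD_sqr innerZr normrZ exprMn real_normK ?num_real//.
have -> : `|f| ^+ 2 + 2 * (- (ip f g / `|g| ^+ 2) * ip f g) + (- (ip f g / `|g| ^+ 2)) ^+ 2 * `|g| ^+ 2
   = (`|f| ^+ 2 * `|g| ^+ 2 - ip f g ^+ 2) / `|g| ^+ 2 by field.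
rewrite pmulr_lge0 ?invr_gt0 ?exprn_gt0// subr_ge0 -exprMn => h.
rewrite -ler_sqr ?qualifE/= ?normr_ge0 ?mulr_ge0//.
by rewrite real_normK ?num_real.
Qed.

(** Riesz representation on a sequentially closed subspace [M]: the vector
    representing [L] minimises [|f|^2 - 2 L f] over [M]. *)
Lemma riesz (M : set H) (L : H -> R) (C : R) :
  M 0 -> (forall a f g, M f -> M g -> M (a *: f + g)) ->
  (forall (f : nat -> H) g, (forall n, M (f n)) -> f @ \oo --> g -> M g) ->
  (forall a f g, M f -> M g -> L (a *: f + g) = a * L f + L g) ->
  (forall f, M f -> `|L f| <= C * `|f|) ->
  exists2 g, M g & forall h, M h -> L h = ip h g.
Proof.
move=> M0 Mlin Mcl Llin LC.
have L0 : L 0 = 0.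
  by apply: (addrI (L 0)); have := Llin 1 _ _ M0 M0; rewrite scale1r mul1r !addr0.
have MZ a f : M f -> M (a *: f) by move=> Mf; have := Mlin a _ _ Mf M0; rewrite addr0.
have LZ a f : M f -> L (a *: f) = a * L f.
  by move=> Mf; have := Llin a _ _ Mf M0; rewrite addr0 L0 addr0.
pose J f := `|f| ^+ 2 - 2 * L f.
pose A := [set J f | f in M].
have J_ge f : M f -> - C ^+ 2 <= J f.
  move=> /LC h; rewrite /J; have := ler_norm (L f); have := sqr_ge0 (`|f| - C); nra.
have Ainf : has_inf A.
  split; first by exists (J 0), 0.
  by exists (- C ^+ 2) => _ [f Mf <-]; exact: J_ge.
set d := inf A.
have d_le f : M f -> d <= J f.
  by move=> Mf; apply: ge_inf; [case: Ainf|exists f].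
have /boolp.choice[f hf] : forall n : nat, exists g, M g /\ J g < d + n.+1%:R^-1.
  move=> n; have n0 : 0 < n.+1%:R^-1 :> R by rewrite invr_gt0 ltr0n.
  have [_ [g Mg <-] hg] := inf_adherent n0 Ainf.
  by exists g.
have Mf n : M (f n) by case: (hf n).
(* parallelogram identity at the midpoint of [f n] and [f m] *)
have par n m : `|f n - f m| ^+ 2 <= 2 * (n.+1%:R^-1 + m.+1%:R^-1).
  have [_ hn] := hf n; have [_ hm] := hf m.
  have Mh : M (2^-1 *: (1 *: f n + f m)) by apply: MZ; exact: Mlin.
  have := d_le _ Mh; rewrite /J LZ; last exact: Mlin.
  rewrite Llin// scale1r mul1r normrZ exprMn !normD_sqr gtr0_norm ?invr_gt0//.
  rewrite normrN [ip _ (- _)]innerC innerNl [ip (f m) _]innerC.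
  have -> : 2^-1 ^+ 2 = 4^-1 :> R by field.
  rewrite /J in hn hm; move: hn hm.
  move: (n.+1%:R^-1) (m.+1%:R^-1) (ip _ _) (`|f n| ^+ 2) (`|f m| ^+ 2) (L _) (L _).
  move=> a1 a2 a3 a4 a5 a6 a7 h1 h2 h3; lra.
have small (e : R) : 0 < e -> exists N, forall n, (N <= n)%N -> n.+1%:R^-1 < e.
  move=> e0; exists (Num.truncn (e^-1)) => n Nn.
  rewrite invf_plt ?posrE ?ltr0n//.
  have /andP[_ h] : (Num.truncn e^-1)%:R <= e^-1 < (Num.truncn e^-1).+1%:R.
    by apply: truncn_itv; rewrite invr_ge0 ltW.
  by apply: lt_le_trans h _; rewrite ler_nat ltnS.
have cf : cvgn f.
  apply: cauchy_cvg; apply: cauchy_exP => e e0.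
  have e4 : 0 < e ^+ 2 / 4 by rewrite divr_gt0// exprn_gt0.
  have [N hN] := small _ e4.
  exists (f N); exists N => // n /= Nn; rewrite -ball_normE /=.
  rewrite -ltr_sqr ?qualifE/= ?normr_ge0 ?ltW//.
  apply: le_lt_trans (par N n) _.
  move: (N.+1%:R^-1) (n.+1%:R^-1) (hN N (leqnn N)) (hN n Nn) => x y hx hy; lra.
set g := limn f.
have fg : f @ \oo --> g by exact: cf.
exists g; first exact: Mcl fg.
move=> h Mh; apply/eqP; rewrite -subr_eq0 -normr_eq0; apply/eqP.
(* move from [f n] in the direction [h] by the step that decreases [J] most *)
have key n : (ip (f n) h - L h) ^+ 2 <= n.+1%:R^-1 * `|h| ^+ 2.
  have [h0|h0] := eqVneq (`|h|) 0.
    have -> : h = 0 by apply/eqP; rewrite -normr_eq0 h0.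
    by rewrite innerC inner0l L0 subrr normr0 !expr0n /= mulr0.
  have hp : 0 < `|h| by rewrite lt_neqAle eq_sym h0 normr_ge0.
  set c := ip (f n) h - L h; pose t := - c / `|h| ^+ 2.
  have := d_le _ (Mlin t _ _ Mh (Mf n)); rewrite /J Llin//.
  rewrite [t *: h + _]addrC normD_sqr innerZr normrZ exprMn real_normK ?num_real// => hd.
  have [_ hn] := hf n; rewrite /J in hn.
  have ht : t ^+ 2 * `|h| ^+ 2 + 2 * (t * c) = - (c ^+ 2 / `|h| ^+ 2) by rewrite /t; field.
  have ec : t * c = t * ip (f n) h - t * L h by rewrite mulrBr.
  rewrite -ler_pdivrMr ?exprn_gt0//; rewrite ec in ht; move: ht hd hn.
  move: (c ^+ 2 / _) (t ^+ 2 * _) (t * ip _ _) (t * L _) (n.+1%:R^-1) (`|f n| ^+ 2) (L (f n)).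
  move=> a1 a2 a3 a4 a5 a6 a7 h1 h2 h3; lra.
apply/eqP; rewrite eq_le normr_ge0 andbT; apply/ler_addgt0Pr => e e0; rewrite add0r.
pose q := e / (2 * (`|h| + 1)).
have h1 : 0 < `|h| + 1 by rewrite ltr_wpDl ?normr_ge0.
have q0 : 0 < q by rewrite divr_gt0// mulr_gt0.
have [N1 hN1] := small _ (mulr_gt0 q0 q0).
have /cvgrPdist_lt /(_ _ q0) [N2 _ hN2] := fg.
pose n := maxn N1 N2.
have h2 : `|g - f n| < q by apply: hN2; rewrite /= leq_maxr.
have h3 : `|ip (f n) h - L h| <= q * `|h|.
  have qh : 0 <= q * `|h| by rewrite mulr_ge0 ?normr_ge0 ?ltW.
  rewrite -ler_sqr ?qualifE/= ?normr_ge0//.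
  rewrite real_normK ?num_real//.
  apply: le_trans (key n) _; rewrite exprMn ler_wpM2r ?sqr_ge0// expr2 ltW//.
  by apply: hN1; rewrite leq_maxl.
have h4 : `|ip (g - f n) h| <= q * `|h|.
  apply: le_trans (cauchy_schwarz _ _) _; rewrite ler_wpM2r ?normr_ge0//; exact: ltW.
have -> : L h - ip h g = - ((ip (f n) h - L h) + ip (g - f n) h).
  by rewrite innerBl (innerC h g); ring.
rewrite normrN; apply: le_trans (ler_normD _ _) _.
have : 2 * q * (`|h| + 1) = e by rewrite /q; field; rewrite gt_eqF.
move: h3 h4 q0; nra.
Qed.

Lemma feval0 x : D x -> feval (0 : H) x = 0.
Proof.
move=> Dx; have := feval_linear 1 (0 : H) 0 Dx; rewrite scale1r mul1r addr0 => h.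
by apply: (addrI (feval (0 : H) x)); rewrite -h addr0.
Qed.

Lemma fevalB f g x : D x -> feval (f - g) x = feval f x - feval g x.
Proof.
by move=> Dx; rewrite -[f - g]addrC -scaleN1r feval_linear// mulN1r addrC.
Qed.

End hilbert.

(** * The mean square worst-case error *)

Lemma preserving_comp (R : realType) d (T : measurableType d) (mu : set T -> \bar R) f g :
  preserving mu f -> preserving mu g -> preserving mu (f \o g).
Proof.
move=> [mf fE] [mg gE]; split; first exact: measurableT_comp.
move=> A mA; rewrite comp_preimage gE ?fE//.
by rewrite -[X in measurable X]setTI; exact: mf.
Qed.

Section rkhs.
Context (R : realType) (s : nat) (H : hilbert_fun_space R (cube R s)).
Local Notation V := (vecR R s).
Local Notation cub := (cube R s).
Local Notation mu := (lebn R s).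
Local Notation ip := (@inner R V cub H).
Variable K : V -> V -> R.
Hypothesis HK : is_reproducing_kernel H K.
Hypothesis KL2 : square_integrable K.
Hypothesis Kdiag : (\int[mu]_(x in cub) (Num.sqrt (K x x))%:E < +oo)%E.

Let mc := @measurable_cube R s.

Lemma reproducing_elements : exists k : V -> H, forall y, cub y ->
  (forall x, cub x -> feval (k y) x = K x y) /\ (forall f, ip f (k y) = feval f y).
Proof.
have /boolp.choice[k hk] : forall y, exists Ky : H, cub y ->
    (forall x, cub x -> feval Ky x = K x y) /\ (forall f, ip f Ky = feval f y).
  move=> y; have [cy|ncy] := pselect (cub y); last by exists 0.
  by have [Ky hKy] := HK cy; exists Ky.
by exists k.
Qed.

Lemma kernel_sym x y : cub x -> cub y -> K x y = K y x.
Proof.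
move=> cx cy; have [k hk] := reproducing_elements.
have [kx ix] := hk _ cx; have [ky iy] := hk _ cy.
by rewrite -ky// -kx// -ix -iy innerC.
Qed.

Lemma kernel_diag_norm x Kx : cub x -> (forall y, cub y -> feval Kx y = K y x) ->
  (forall f, ip f Kx = feval f x) -> `|Kx| = Num.sqrt (K x x).
Proof.
by move=> cx h1 h2; rewrite -h1// -h2 inner_norm sqrtr_sqr ger0_norm ?normr_ge0.
Qed.

Lemma normr_feval_le (f : H) x : cub x -> `|feval f x| <= `|f| * Num.sqrt (K x x).
Proof.
move=> cx; have [k hk] := reproducing_elements; have [h1 h2] := hk _ cx.
by rewrite -h2 -(kernel_diag_norm cx h1 h2); exact: cauchy_schwarz.
Qed.

Lemma measurable_kernel_sections y : cub y -> measurable_fun cub (fun x => K x y).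
Proof.
move=> cy; apply: (@eq_measurable_fun _ _ _ _ _ (fun x => ext_kernel K (x, y))).
  by move=> x; rewrite inE => cx; rewrite ext_kernelE.
apply: (measurable_funS measurableT) => //.
have mp : measurable_fun setT (fun x : V => (x, y)).
  by apply: measurable_fun_pair => //; exact: measurable_cst.
exact: (measurableT_comp (measurable_ext_kernel KL2) mp).
Qed.

Lemma measurable_sqrt_diag : measurable_fun cub (fun x => Num.sqrt (K x x)).
Proof.
apply: (@eq_measurable_fun _ _ _ _ _ (fun x => Num.sqrt (ext_kernel K (x, x)))).
  by move=> x; rewrite inE => cx; rewrite ext_kernelE.
apply: (measurable_funS measurableT) => //.
have mp : measurable_fun setT (fun x : V => (x, x)) by exact: measurable_fun_pair.
have mk := measurableT_comp (measurable_ext_kernel KL2) mp.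
exact: (measurableT_comp (continuous_measurable_fun (@sqrt_continuous R)) mk).
Qed.

(** Every function of the space is measurable: the measurable ones form a
    closed subspace containing all kernel sections [K(., y)], and a vector
    agrees everywhere with its projection on it. *)
Lemma measurable_feval (f : H) : measurable_fun cub (feval f).
Proof.
pose M := [set g : H | measurable_fun cub (feval g)].
have [k hk] := reproducing_elements.
have Mk y : cub y -> M (k y).
  move=> cy; have [h1 _] := hk _ cy.
  apply: (@eq_measurable_fun _ _ _ _ _ (fun x => K x y)).
    by move=> x; rewrite inE => cx; rewrite h1.
  exact: measurable_kernel_sections.
have M0 : M 0.
  apply: (@eq_measurable_fun _ _ _ _ _ (fun=> 0 : R)); last exact: measurable_cst.
  by move=> x; rewrite inE => cx; rewrite feval0.
have Mlin a g h : M g -> M h -> M (a *: g + h).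
  move=> Mg Mh; apply: (@eq_measurable_fun _ _ _ _ _ (fun x => a * feval g x + feval h x)).
    by move=> x; rewrite inE => cx; rewrite feval_linear.
  by apply: measurable_funD => //; apply: measurable_funM => //; exact: measurable_cst.
have Mcl (u : nat -> H) g : (forall n, M (u n)) -> u @ \oo --> g -> M g.
  move=> Mu ug; apply: (measurable_fun_cvg Mu) => x cx.
  apply/cvgrPdist_lt => e e0.
  have q0 : 0 < e / (Num.sqrt (K x x) + 1).
    by rewrite divr_gt0// ltr_wpDl// sqrtr_ge0.
  have /cvgrPdist_lt/(_ _ q0)[N _ hN] := ug.
  exists N => // n /= Nn; rewrite -fevalB//.
  apply: le_lt_trans (normr_feval_le _ cx) _.
  have := hN n Nn => /=; have := sqrtr_ge0 (K x x); have := normr_ge0 (g - u n).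
  move: (`|g - u n|) (Num.sqrt (K x x)) => p q p0 q1.
  rewrite ltr_pdivlMr ?ltr_wpDl//; nra.
have [g Mg hg] := @riesz _ _ _ H M (fun h => ip h f) (`|f|) M0 Mlin Mcl
  ltac:(by move=> a h h' _ _ /=; rewrite inner_linear)
  ltac:(by move=> h _ /=; rewrite mulrC; exact: cauchy_schwarz).
suff -> : f = g by [].
apply: feval_inj => x cx; have [_ h2] := hk _ cx.
by rewrite -!h2 ![ip _ (k x)]innerC; apply: hg; exact: Mk.
Qed.

Lemma integrable_sqrt_diag : mu.-integrable cub (EFin \o (fun x => Num.sqrt (K x x))).
Proof.
apply/integrableP; split; first by apply/measurable_EFinP; exact: measurable_sqrt_diag.
by under eq_integral do rewrite /= ger0_norm ?sqrtr_ge0//.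
Qed.

Lemma integrable_feval (f : H) : mu.-integrable cub (EFin \o feval f).
Proof.
have i1 : mu.-integrable cub (EFin \o (fun x => `|f| * Num.sqrt (K x x))).
  by have := integrableZl mc (`|f|) integrable_sqrt_diag; exact: eq_integrable.
apply: (le_integrable mc _ _ i1); first by apply/measurable_EFinP; exact: measurable_feval.
move=> x cx; rewrite /= lee_fin [leRHS]ger0_norm ?mulr_ge0 ?sqrtr_ge0 ?normr_ge0//.
exact: normr_feval_le.
Qed.

(** The representer of the integration functional. *)
Lemma integral_representer : exists g : H, forall f, Ifun f = ip f g.
Proof.
pose C := \int[mu]_(x in cub) Num.sqrt (K x x).
have [g _ hg] := @riesz _ _ _ H setT (@Ifun R s H) C I (fun _ _ _ _ _ => I) (fun _ _ _ _ => I)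
  ltac:(move=> a f h _ _; rewrite /Ifun -RintegralZl//; [|exact: integrable_feval];
    rewrite -RintegralD//; [|
      by have := integrableZl mc a (integrable_feval f); exact: eq_integrable
      |exact: integrable_feval];
    by apply: eq_Rintegral => x; rewrite inE => cx; rewrite feval_linear)
  ltac:(move=> f _; rewrite /Ifun; apply: le_trans (le_normr_Rintegral mc (integrable_feval f)) _;
    rewrite mulrC /C -RintegralZl//; [|exact: integrable_sqrt_diag];
    apply: le_Rintegral => //; [exact: integrable_abse (integrable_feval f)
      |by have := integrableZl mc (`|f|) integrable_sqrt_diag; exact: eq_integrable
      |by move=> x cx; exact: normr_feval_le]).
by exists g => f; exact: hg.
Qed.

End rkhs.

Section wce.
Context (R : realType) (s : nat) (H : hilbert_fun_space R (cube R s)).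
Local Notation V := (vecR R s).
Local Notation cub := (cube R s).
Local Notation mu := (lebn R s).
Local Notation mu2 := (leb2 R s).
Local Notation ip := (@inner R V cub H).

Lemma ereal_sup_inner (xi : H) :
  ereal_sup [set `|ip f xi|%:E | f in [set f : H | `|f| <= 1]] = (`|xi|)%:E.
Proof.
apply/eqP; rewrite eq_le; apply/andP; split.
  apply: ge_ereal_sup => _ [f /= f1 <-]; rewrite lee_fin.
  by apply: le_trans (cauchy_schwarz _ _) _; rewrite ler_piMl ?normr_ge0.
apply: ereal_sup_ubound; have [xi0|xi0] := eqVneq (`|xi|) 0.
  exists 0; first by rewrite /= normr0.
  by rewrite inner0l normr0 xi0.
exists (`|xi|^-1 *: xi) => /=.
  by rewrite normrZ ger0_norm ?invr_ge0 ?normr_ge0// mulVf.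
congr EFin; rewrite innerZl inner_norm expr2 mulrA mulVf// mul1r.
by rewrite ger0_norm ?normr_ge0.
Qed.

Variable K : V -> V -> R.
Hypothesis HK : is_reproducing_kernel H K.
Variable g : H.
Hypothesis hg : forall f, Ifun f = ip f g.

(** The error functional is represented by [g] minus the mean of the kernel
    sections at the points of [P]. *)
Lemma sq_wceE N (P : N.-tuple V) : (0 < N)%N -> (forall x, x \in P -> cub x) ->
  sq_wce H P = (`|g| ^+ 2 - 2 / N%:R * \sum_(x <- P) feval g x +
     N%:R ^- 2 * \sum_(x <- P) \sum_(y <- P) K x y)%:E.
Proof.
move=> N0 hP; have [k hk] := reproducing_elements HK.
pose q : H := N%:R^-1 *: \sum_(x <- P) k x.
have hq f : Qfun P f = ip f q.
  rewrite /Qfun /q innerZr inner_sumr; congr (_ * _).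
  by apply: eq_big_seq => x /hP cx; have [_ ->] := hk _ cx.
rewrite /sq_wce (_ : [set _ | f in _] = [set `|ip f (g - q)|%:E | f in [set f : H | `|f| <= 1]]); last first.
  by apply/eq_imagel => f _; rewrite hg hq innerBr.
rewrite ereal_sup_inner -EFin_expe; congr EFin.
rewrite normD_sqr normrN [ip g _]innerC innerNl; congr (_ + _ + _).
  rewrite innerC -hq /Qfun; field; by rewrite pnatr_eq0 -lt0n.
rewrite -inner_norm {1}/q innerZl innerC inner_sumr mulr_sumr mulr_sumr.
apply: eq_big_seq => x /hP cx; have [h1 h2] := hk _ cx.
rewrite h2 -h2 innerC /q innerZr inner_sumr mulrA -invfM expr2; congr (_ * _).
by apply: eq_big_seq => y /hP cy; have [_ ->] := hk _ cy; rewrite h1 // (kernel_sym HK).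
Qed.

End wce.

Section mean.
Context (R : realType) (b : nat) (hb : (1 < b)%N) (s : nat) (H : hilbert_fun_space R (cube R s)).
Local Notation V := (vecR R s).
Local Notation cub := (cube R s).
Local Notation mu := (lebn R s).
Local Notation mu2 := (leb2 R s).
Local Notation ip := (@inner R V cub H).
Let mc := @measurable_cube R s.

(** [f] is integrable on the cube with integral [r]. *)
Let has_int (f : V -> R) (r : R) :=
  mu.-integrable cub (EFin \o f) /\ (\int[mu]_(x in cub) (f x)%:E = r%:E)%E.

Let has_int_ext f f' r : (forall x, cub x -> f x = f' x) -> has_int f r -> has_int f' r.
Proof.
move=> e [i1 i2]; split.
  by apply: eq_integrable i1 => // x; rewrite inE => cx; rewrite /= e.
by rewrite -i2; apply: eq_integral => x; rewrite inE => cx; rewrite e.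
Qed.

Let has_intD f f' r r' : has_int f r -> has_int f' r' -> has_int (fun x => f x + f' x) (r + r').
Proof.
move=> [i1 i2] [j1 j2]; split.
  by have := integrableD mc i1 j1; exact: eq_integrable.
by under eq_integral do rewrite EFinD; rewrite integralD// i2 j2.
Qed.

Let has_intZ a f r : has_int f r -> has_int (fun x => a * f x) (a * r).
Proof.
move=> [i1 i2]; split; first by have := integrableZl mc a i1; exact: eq_integrable.
by under eq_integral do rewrite EFinM; rewrite integralZl// i2.
Qed.

Let has_int_cst c : has_int (fun=> c) c.
Proof.
split; last by rewrite integral_cst//= [X in (_ * X)%E]lebn_cube mule1.
apply/integrableP; split; first exact: measurable_cst.
by rewrite integral_cst//= [X in (_ * X)%E]lebn_cube mule1 ltry.
Qed.

Let has_int_sum (I : eqType) (t : seq I) (F : I -> V -> R) (v : I -> R) :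
  (forall i, i \in t -> has_int (F i) (v i)) ->
  has_int (fun x => \sum_(i <- t) F i x) (\sum_(i <- t) v i).
Proof.
elim: t => [|i t IH] h.
  rewrite big_nil; apply: has_int_ext (has_int_cst 0) => x _; by rewrite big_nil.
rewrite big_cons; apply: (@has_int_ext (fun x => F i x + \sum_(j <- t) F j x)).
  by move=> x _; rewrite big_cons.
apply: has_intD; first by apply: h; rewrite mem_head.
by apply: IH => j jt; apply: h; rewrite in_cons jt orbT.
Qed.

Variable K : V -> V -> R.
Hypothesis HK : is_reproducing_kernel H K.
Hypothesis KL2 : square_integrable K.
Hypothesis Kdiag : (\int[mu]_(x in cub) (Num.sqrt (K x x))%:E < +oo)%E.
Hypothesis Ksh_fin : forall x y, cub x -> cub y -> shifted_kernel b K x y \is a fin_num.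

(** The random point [phi_b (x (+) sigma)] is uniformly distributed. *)
Let has_int_folded (f : H) x : cub x ->
  has_int (fun sg => feval f (vec_tent b (vec_oplus b x sg))) (Ifun f).
Proof.
move=> cx; pose phi sg : V := vec_tent_ext b (vec_shift b sg x).
have cphi sg : cub (phi sg) <-> cub sg by rewrite /phi cube_vec_tent_ext// cube_vec_shift.
apply: (@has_int_ext (fun sg => feval f (phi sg))).
  move=> sg cs; rewrite vec_oplusC vec_oplusE// vec_tentE//.
  by apply/(cube_vec_shift hb).
have pphi : preserving mu phi.
  exact: (preserving_comp (preserving_vec_tent_ext R hb s) (preserving_vec_shift hb cx)).
have If : mu.-integrable setT ((EFin \o feval f) \_ cub).
  exact: (proj1 (integrable_mkcond _ mc) (integrable_feval HK KL2 Kdiag f)).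
have e : (EFin \o (fun sg => feval f (phi sg))) \_ cub = ((EFin \o feval f) \_ cub) \o phi.
  apply/funext => sg; rewrite /= !patchE; have [cs|cs] := pselect (cub sg).
    by rewrite !mem_set//; exact/cphi.
  by rewrite !memNset// => /cphi.
split.
  by apply/(integrable_mkcond _ mc); rewrite e; exact: (integrable_preserving pphi If).
rewrite integral_mkcond [X in (\int[_]_x X x)%E]e (integral_preserving pphi If).
rewrite -integral_mkcond /Ifun fineK//.
exact: integrable_fin_num (integrable_feval HK KL2 Kdiag f).
Qed.

Let has_int_kernel x y : cub x -> cub y ->
  has_int (fun sg => K (vec_tent b (vec_oplus b x sg)) (vec_tent b (vec_oplus b y sg)))
    (fine (shifted_kernel b K x y)).
Proof.
move=> cx cy; split; last by rewrite fineK// Ksh_fin.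
have := integrable_shifted_folded hb KL2 Ksh_fin cx cy.
apply: eq_integrable => // sg; rewrite inE => cs.
have cx' : cub (vec_shift b x sg) by apply/(cube_vec_shift hb).
have cy' : cub (vec_shift b y sg) by apply/(cube_vec_shift hb).
rewrite /folded_kernel /pair_tent /pair_shift /= ext_kernelE ?cube_vec_tent_ext//.
by rewrite !vec_oplusE// !vec_tentE.
Qed.

Lemma mean_sq_wceE (g : H) N (P : N.-tuple V) : (forall f, Ifun f = ip f g) ->
  (0 < N)%N -> (forall x, x \in P -> cub x) ->
  mean_sq_wce H b P = (N%:R ^- 2 *
     \sum_(x <- P) \sum_(y <- P) fine (shifted_kernel b K x y) - `|g| ^+ 2)%:E.
Proof.
move=> hg N0 hP.
pose ph x sg : V := vec_tent b (vec_oplus b x sg).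
pose e sg := `|g| ^+ 2 + (- (2 / N%:R)) * \sum_(x <- P) feval g (ph x sg) +
     N%:R ^- 2 * \sum_(x <- P) \sum_(y <- P) K (ph x sg) (ph y sg).
have [_ he] : has_int e (`|g| ^+ 2 + (- (2 / N%:R)) * \sum_(x <- P) `|g| ^+ 2 +
     N%:R ^- 2 * \sum_(x <- P) \sum_(y <- P) fine (shifted_kernel b K x y)).
  apply: has_intD; last first.
    apply: has_intZ; apply: has_int_sum => x /hP cx; apply: has_int_sum => y /hP cy.
    exact: has_int_kernel.
  apply: has_intD; first exact: has_int_cst.
  apply: has_intZ; apply: has_int_sum => x /hP cx.
  by rewrite -inner_norm -hg; exact: has_int_folded.
transitivity (\int[mu]_(sg in cub) (e sg)%:E)%E.
  apply: eq_integral => sg; rewrite inE => cs.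
  rewrite (sq_wceE HK hg N0); last first.
    move=> y /tnthP[i ->]; rewrite tnth_mktuple.
    have cp : cub (tnth P i) by apply: hP; exact: mem_tnth.
    rewrite vec_oplusE// vec_tentE ?cube_vec_tent_ext//; exact/(cube_vec_shift hb).
  have eF (F : V -> R) : \sum_(x <- fold_shift b P sg) F x = \sum_(x <- P) F (ph x sg).
    by rewrite !big_tuple; apply: eq_bigr => i _; rewrite tnth_mktuple.
  rewrite !eF; congr EFin; rewrite /e mulNr; congr (_ + _ * _).
  by apply: eq_bigr => x _; rewrite eF.
rewrite he; congr EFin; rewrite big_const_seq count_predT size_tuple iter_addr_0.
rewrite -[_ *+ N]mulr_natr; field; by rewrite pnatr_eq0 -lt0n.
Qed.

Lemma walsh_coef0E (g : H) : (forall f, Ifun f = ip f g) ->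
  walsh_coef b K [tuple 0%N | j < s] [tuple 0%N | j < s] = (`|g| ^+ 2)%:C%C.
Proof.
move=> hg; have [k hk] := reproducing_elements HK.
have w0 (x : V) : vec_wal b [tuple 0%N | j < s] x = 1.
  by rewrite /vec_wal; apply: big1 => j _; rewrite tnth_mktuple wal0.
have iK := integrable_ext_kernel KL2.
rewrite walsh_coefE /Cintegral.
have e (z : V * V) : walsh_pair b [tuple 0%N | j < s] [tuple 0%N | j < s] z = 1.
  by rewrite /walsh_pair !w0 mulr1 rmorph1.
have -> : \int[mu2]_z complex.Im ((ext_kernel K z)%:C%C * walsh_pair b [tuple 0%N | j < s] [tuple 0%N | j < s] z) = 0.
  by under eq_Rintegral do rewrite e mulr1 /=; rewrite /Rintegral integral0.
congr (_ +i* _)%C; under eq_Rintegral do rewrite e mulr1 /=.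
rewrite -inner_norm -hg /Ifun /Rintegral; congr fine.
transitivity (\int[mu]_y \int[mu]_x (ext_kernel K (x, y))%:E)%E.
  by apply/esym; exact: (integral21_prod_meas1 iK).
rewrite [RHS]integral_mkcond; apply: eq_integral => y _; rewrite patchE.
case: ifPn => cy; last first.
  rewrite integral0_eq// => x _; rewrite ext_kernel_out// => -[_ /= cy'].
  by move: cy; rewrite mem_set.
have [h1 h2] := hk _ (set_mem cy).
rewrite -h2 innerC -hg /Ifun fineK; last first.
  exact: integrable_fin_num (integrable_feval HK KL2 Kdiag (k y)).
rewrite [RHS]integral_mkcond; apply: eq_integral => x _; rewrite patchE.
case: ifPn => cx; last by rewrite ext_kernel_out// => -[/= cx' _]; move: cx; rewrite mem_set.
rewrite /= ext_kernelE ?h1//; exact: set_mem.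
Qed.

End mean.

(** * Absolutely convergent sums *)

Section summation.
Context (C : numFieldType).
Local Open Scope fset_scope.
Local Open Scope ring_scope.

(** [f] is absolutely summable over its index type, with sum [z]. *)
Definition abs_summing (I : choiceType) (f : I -> C) (z : C) :=
  (exists M, forall F : {fset I}, \sum_(i <- F) `|f i| <= M) /\
  (forall e, 0 < e -> exists F0 : {fset I}, forall F : {fset I}, F0 `<=` F ->
     `|z - \sum_(i <- F) f i| < e).

Section closure.
Context (I : choiceType).
Implicit Types (f g : I -> C).

Lemma abs_summing_ext f g z : f =1 g -> abs_summing f z -> abs_summing g z.
Proof. by move=> /funext ->. Qed.

Lemma abs_summingD f g z w : abs_summing f z -> abs_summing g w ->
  abs_summing (fun i => f i + g i) (z + w).
Proof.
move=> [[M hM] hf] [[N hN] hg]; split.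
  exists (M + N) => F; apply: le_trans (lerD (hM F) (hN F)).
  by rewrite -big_split /=; apply: ler_sum => i _; exact: ler_normD.
move=> e e0; have e2 : 0 < e / 2 by rewrite divr_gt0.
have [F0 h0] := hf _ e2; have [F1 h1] := hg _ e2.
exists (F0 `|` F1) => F; rewrite fsubUset => /andP[/h0 k0 /h1 k1].
rewrite big_split /= opprD addrACA (le_lt_trans (ler_normD _ _))//.
by rewrite (splitr e) ltrD.
Qed.

Lemma abs_summingZ c f z : abs_summing f z -> abs_summing (fun i => c * f i) (c * z).
Proof.
move=> [[M hM] hf]; split.
  exists (`|c| * M) => F; under eq_bigr do rewrite normrM.
  by rewrite -mulr_sumr ler_wpM2l ?normr_ge0.
move=> e e0; have c1 : 0 < `|c| + 1 by rewrite ltr_wpDl ?normr_ge0.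
have [F0 h0] := hf _ (divr_gt0 e0 c1); exists F0 => F /h0.
rewrite ltr_pdivlMr// -mulr_sumr -mulrBr normrM => h; apply: le_lt_trans h.
by rewrite mulrC ler_wpM2l ?normr_ge0// lerDl.
Qed.

Lemma abs_summing0 : abs_summing (fun _ : I => 0) 0.
Proof.
split; first by exists 0 => F; rewrite big1// => i _; rewrite normr0.
by move=> e e0; exists fset0 => F _; rewrite big1// subr0 normr0.
Qed.

Lemma abs_summing_sum (J : eqType) (r : seq J) (f : J -> I -> C) (z : J -> C) :
  (forall j, j \in r -> abs_summing (f j) (z j)) ->
  abs_summing (fun i => \sum_(j <- r) f j i) (\sum_(j <- r) z j).
Proof.
elim: r => [|j r IH] h.
  rewrite big_nil; apply: abs_summing_ext abs_summing0 => i; by rewrite big_nil.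
rewrite big_cons; apply: (@abs_summing_ext (fun i => f j i + \sum_(k <- r) f k i)).
  by move=> i; rewrite big_cons.
apply: abs_summingD; first by apply: h; rewrite mem_head.
by apply: IH => k kr; apply: h; rewrite in_cons kr orbT.
Qed.

Lemma abs_summing1 (k : I) (c : C) : abs_summing (fun i => if i == k then c else 0) c.
Proof.
have e (D : zmodType) (G : I -> D) (F : {fset I}) : (forall i, i != k -> G i = 0) ->
    \sum_(i <- F) G i = if k \in F then G k else 0.
  move=> hG; case: ifPn => kF.
    by rewrite (bigD1_seq k)//= big1 ?addr0.
  rewrite big_seq big1// => i iF; apply: hG; apply: contraNneq kF => <-; exact: iF.
split.
  exists `|c| => F; rewrite e => [|i /negbTE->]; last by rewrite normr0.
  by rewrite eqxx; case: ifP.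
move=> d d0; exists [fset k] => F; rewrite fsub1set => kF.
by rewrite e => [|i /negbTE->//]; rewrite kF eqxx subrr normr0.
Qed.

(** A family supported on the diagonal is summed along the diagonal. *)
Lemma abs_summing_diag (h : I * I -> C) z : abs_summing h z ->
  (forall p, p.1 != p.2 -> h p = 0) -> abs_summing (fun i => h (i, i)) z.
Proof.
move=> [[M hM] hz] hd.
have dinj : injective (fun i : I => (i, i)) by move=> i j [].
have eD (D : zmodType) (G : I * I -> D) (F : {fset I}) :
    \sum_(p <- [fset (i, i) | i in F]) G p = \sum_(i <- F) G (i, i).
  by rewrite big_imfset//= => i j _ _; exact: dinj.
split; first by exists M => F; rewrite -(eD _ (fun p => `|h p|)).
move=> e /hz[F0 hF0]; exists [fset p.1 | p in F0] => F F0F.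
have := hF0 (F0 `|` [fset (i, i) | i in F]) (fsubsetUl _ _).
rewrite -(@big_fset_incl _ _ _ _ [fset (i, i) | i in F]) ?eD//; first exact: fsubsetUr.
move=> [i j]; rewrite inE => /orP[ijF0|->//] /negP nF; apply: hd => /=.
apply/negP => /eqP ij; apply: nF; rewrite -ij; apply/imfsetP; exists i => //=.
by apply: (fsubsetP F0F); apply/imfsetP; exists (i, j).
Qed.

End closure.
End summation.

Section sums_to.
Context (R : realType) (I : choiceType) (A : set I) (f : I -> R[i]).
Let fA (i : I) : R[i] := if i \in A then f i else 0.

Let sum_mkcond (F : {fset I}) : \sum_(i <- F | i \in A) f i = \sum_(i <- F) fA i.
Proof. exact: big_mkcond. Qed.

Let norm_mkcond (F : {fset I}) :
  ((\sum_(i <- F | i \in A) complex.Re `|f i|)%:C)%C = \sum_(i <- F) `|fA i|.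
Proof.
rewrite big_mkcond rmorph_sum /=; apply: eq_bigr => i _; rewrite /fA.
case: ifP => _; last by rewrite normr0.
by rewrite [RHS]normc_def; case: (f i).
Qed.

(** [sums_to] over [A] amounts to summing the extension by zero. *)
Lemma sums_toP r : sums_to A f r%:E <-> abs_summing fA (r%:C)%C.
Proof.
have totF := @summability.totally_filter I.
split.
  move=> [_ [[<-] sf cf]]; split.
    have sge0 : (0 <= \esum_(i in A) (complex.Re `|f i|)%:E)%E.
      by apply: esum_ge0 => i _; rewrite normc_def lee_fin /= sqrtr_ge0.
    exists ((fine (\esum_(i in A) (complex.Re `|f i|)%:E))%:C)%C => F.
    rewrite -norm_mkcond lecR -lee_fin fineK ?ge0_fin_numE//.
    rewrite -sumEFin -big_filter; apply: esum_ge.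
    exists [set` [seq i <- F | i \in A]]; last by rewrite -fsbig_seq// filter_uniq.
    split; first exact: finite_seq.
    by move=> i; rewrite /= mem_filter => /andP[/set_mem].
  move=> e e0; have := proj1 (@cvgrPdist_lt _ (R[i]^o) _ _ _ _ _) cf e e0.
  by move=> [F0 _ hF0]; exists F0 => F F0F; rewrite -sum_mkcond; exact: hF0.
move=> [[M hM] hf]; exists r; split => //.
  apply: (@le_lt_trans _ _ (complex.Re M)%:E); last exact: ltry.
  apply: ge_ereal_sup => _ [X [fX XA] <-].
  rewrite fsbig_finite// sumEFin lee_fin.
  have := hM (fset_set X); rewrite -norm_mkcond lecE /= => /andP[_]; apply: le_trans.
  rewrite big_seq [leRHS]big_seq_cond.
  rewrite (eq_bigl (fun i => (i \in fset_set X) && (i \in A)))// => i.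
  rewrite in_fset_set// andb_idr// !inE; exact: XA.
apply: (proj2 (@cvgrPdist_lt _ (R[i]^o) _ _ _ _ _)) => e /hf[F0 hF0]; exists F0 => // F /= F0F.
by rewrite sum_mkcond; exact: hF0.
Qed.

End sums_to.

(** * Character sums over digital nets *)

Section digital_net.
Context (R : realType) (b : nat) (hb : (1 < b)%N) (s n : nat).
Local Notation V := (vecR R s).

(** The digits of the [j]-th coordinate of a net point. *)
Definition net_digits (M : 'M['Z_b]_(s, n)) (j : 'I_s) (i : nat) : 'Z_b :=
  if insub i is Some o then M j o else 0.

Lemma net_digits_ord M j (i : 'I_n) : net_digits M j i = M j i.
Proof. by rewrite /net_digits valK. Qed.

Lemma net_digits_ge M j i : (n <= i)%N -> net_digits M j i = 0.
Proof. by move=> ni; rewrite /net_digits insubF// ltnNge ni. Qed.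

Lemma badic_value_finite (xi : nat -> 'Z_b) :
  (forall i, (n <= i)%N -> xi i = 0) -> badic_value R xi = badic_sum R xi n.
Proof.
move=> h; apply: cvg_lim => //; apply: cvg_near_cst; exists n => // m /= nm.
rewrite /badic_sum !seriesEnat /= (big_cat_nat (leq0n n) nm) /= [X in _ + X]big_nat_cond.
by rewrite [X in _ + X]big1 ?addr0// => i /andP[/andP[/h -> _] _]; rewrite mul0r.
Qed.

Lemma net_pointE (M : 'M['Z_b]_(s, n)) j :
  tnth (net_point R M) j = badic_value R (net_digits M j).
Proof.
rewrite badic_value_finite; last by move=> i; exact: net_digits_ge.
rewrite tnth_mktuple /badic_sum seriesEnat /= big_mkord.
by apply: eq_bigr => i _; rewrite net_digits_ord.
Qed.

Lemma digits_net_point (M : 'M['Z_b]_(s, n)) j :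
  digits b (tnth (net_point R M) j : R) = net_digits M j.
Proof.
rewrite net_pointE digits_value//; right => m; exists (maxn m n); first exact: leq_maxl.
rewrite net_digits_ge ?leq_maxr// => e; have : 0%N = b.-1 by [].
by move: hb; clear; case: b => [|[]].
Qed.

Lemma net_point_inj : injective (@net_point R b s n).
Proof.
move=> M M' e; apply/matrixP => j i.
by rewrite -!net_digits_ord -!digits_net_point e.
Qed.

Lemma cube_net_point (M : 'M['Z_b]_(s, n)) : cube R s (net_point R M).
Proof. by apply/cubeP => j; rewrite net_pointE; exact: badic_value01. Qed.

(** The exponent of [omega] in the value of [wal_k] at a net point; it is additive
    in the digit matrix. *)
Definition net_pairing (k : s.-tuple nat) (M : 'M['Z_b]_(s, n)) : 'Z_b :=
  \sum_(j < s) \sum_(i < n) (nat_digit b (tnth k j) i)%:R * M j i.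

Lemma net_pairingD k M M' : net_pairing k (M + M') = net_pairing k M + net_pairing k M'.
Proof.
rewrite /net_pairing -big_split /=; apply: eq_bigr => j _.
by rewrite -big_split /=; apply: eq_bigr => i _; rewrite mxE mulrDr.
Qed.

Lemma vec_wal_net_point k M : vec_wal b k (net_point R M) = omegaZ R (net_pairing k M).
Proof.
rewrite /vec_wal /net_pairing omegaZ_sum//; apply: eq_bigr => j _.
rewrite (walE hb _ (leq_maxl _ n)); congr omegaZ.
rewrite digits_net_point /walsh_form -(big_mkord xpredT (fun i =>
  (nat_digit b (tnth k j) i)%:R * net_digits M j i)).
rewrite (big_cat_nat (leq0n n) (leq_maxr _ _)) /= [X in _ + X]big_nat_cond [X in _ + X]big1; last first.
  by move=> i /andP[/andP[ni _] _]; rewrite net_digits_ge ?mulr0.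
by rewrite addr0 big_mkord; apply: eq_bigr => i _; rewrite net_digits_ord.
Qed.

Lemma dual_netP m (P : (b ^ m).-tuple V) k :
  (forall x, x \in P -> exists M, x = @net_point R b s n M) ->
  dual_net n P k <-> forall M, net_point R M \in P -> net_pairing k M = 0.
Proof.
move=> hP.
have e M : (b %| \sum_(j < s) \sum_(i < n)
       nat_digit b (tnth k j) i * digits b (tnth (net_point R M) j : R) i)%N = (net_pairing k M == 0).
  rewrite (dvdn_natr_Zp hb) natr_sum; congr (_ == _); apply: eq_bigr => j _.
  rewrite natr_sum; apply: eq_bigr => i _.
  by rewrite natrM digits_net_point net_digits_ord natr_Zp.
split => h; first by move=> M /h; rewrite e => /eqP.
by move=> x xP; have [M xM] := hP x xP; rewrite xM e; apply/eqP/h; rewrite -xM.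
Qed.

(** Orthogonality of characters on the group of digit matrices of the net. *)
Lemma sum_wal_digital_net m (P : (b ^ m).-tuple V) k : digital_net n P ->
  \sum_(x <- P) vec_wal b k x = if `[< dual_net n P k >] then (b ^ m)%:R else 0.
Proof.
move=> [uP hP [G0 GB]]; set G := [set M | _]%SET in G0 GB.
case: asboolP => hk.
  rewrite -[in RHS](size_tuple P) -sum1_size natr_sum; apply: eq_big_seq => x xP.
  have [M xM] := hP x xP; rewrite xM vec_wal_net_point.
  by move/(dual_netP k hP) : hk => ->; rewrite ?omegaZ0// -xM.
have [M0 M0P hM0] : exists2 M0, net_point R M0 \in P & net_pairing k M0 <> 0.
  apply: contrapT => h; apply: hk; apply/(dual_netP k hP) => M MP.
  by apply: contrapT => ?; apply: h; exists M.
have eP : \sum_(x <- P) vec_wal b k x = \sum_(M in G) omegaZ R (net_pairing k M).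
  rewrite (perm_big [seq net_point R M | M <- enum G]) /=; last first.
    apply: uniq_perm => //; first by rewrite map_inj_uniq ?enum_uniq//; exact: net_point_inj.
    move=> x; apply/idP/mapP; last by move=> [M + ->]; rewrite mem_enum inE.
    by move=> xP; have [M xM] := hP x xP; exists M => //; rewrite mem_enum inE -xM.
  by rewrite big_map big_enum; apply: eq_bigr => M _; rewrite vec_wal_net_point.
have M0G : M0 \in G by rewrite inE.
have GD M : (M + M0 \in G) = (M \in G).
  have GN : - M0 \in G by rewrite -sub0r; exact: GB.
  apply/idP/idP => h; first by rewrite -(addrK M0 M); exact: GB.
  by rewrite -(opprK M0); exact: GB.
rewrite eP; set S := (X in X = _).
have SE : S = omegaZ R (net_pairing k M0) * S.
  rewrite [LHS](reindex_inj (addIr M0)) /= (eq_bigl _ _ GD) mulr_sumr.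
  by apply: eq_bigr => M _; rewrite net_pairingD omegaZD// mulrC.
have : (1 - omegaZ R (net_pairing k M0)) * S = 0 by rewrite mulrBl mul1r -SE subrr.
move=> /eqP; rewrite mulf_eq0 => /orP[|/eqP//]; rewrite subr_eq0 => /eqP/esym e1.
by case: hM0; exact: (omegaZ_eq1 (R := R) hb).
Qed.

End digital_net.

(** * The mean square worst-case error formula *)

Lemma index_setP b s (k : s.-tuple nat) :
  index_set b s k <-> digit_sums_dvd b k /\ k != [tuple 0%N | j < s].
Proof.
split=> -[h /eqP k0]; split=> // j.
  case: (h j) => [[_]//|/= ->].
  by rewrite /sum_of_digits big_ord0 dvdn0.
by have [->|kj] := posnP (tnth k j); [right|left; split => //; exact: h].
Qed.

Lemma vec_wal0 (R : realType) b s (x : vecR R s) : vec_wal b [tuple 0%N | j < s] x = 1.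
Proof. by rewrite /vec_wal; apply: big1 => j _; rewrite tnth_mktuple wal0. Qed.

Section mean_square_error.
Context (R : realType) (b s : nat) (hb : (1 < b)%N).
Local Notation V := (vecR R s).
Local Notation cub := (cube R s).
Local Notation mu := (lebn R s).
Variables (K : V -> V -> R) (H : hilbert_fun_space R cub).
Hypothesis HK : is_reproducing_kernel H K.
Hypothesis Kdiag : (\int[mu]_(x in cub) (Num.sqrt (K x x))%:E < +oo)%E.
Hypothesis KL2 : square_integrable K.
Hypothesis Ksh_walsh : forall x y, cub x -> cub y ->
  sums_to [set: s.-tuple nat * s.-tuple nat]
    (fun kl =>
      walsh_coef b (fun x y => fine (shifted_kernel b K x y)) kl.1 kl.2
      * vec_wal b kl.1 x * (vec_wal b kl.2 y)^*)
    (shifted_kernel b K x y).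

Lemma shifted_kernel_fin_num x y : cub x -> cub y -> shifted_kernel b K x y \is a fin_num.
Proof. by move=> cx cy; have [r [-> _ _]] := Ksh_walsh cx cy. Qed.

(** The diagonal Walsh coefficients of the folded shifted kernel. *)
Let coef (k : s.-tuple nat) : R[i] :=
  if `[< digit_sums_dvd b k >] then walsh_coef b K (vec_floor b k) (vec_floor b k) else 0.

Lemma abs_summing_shifted_kernel x y : cub x -> cub y ->
  abs_summing (fun k => coef k * vec_wal b k x * (vec_wal b k y)^*)
    (fine (shifted_kernel b K x y))%:C%C.
Proof.
move=> cx cy; have fin := shifted_kernel_fin_num cx cy.
have := Ksh_walsh cx cy; rewrite -[X in sums_to _ _ X](fineK fin) => /sums_toP h.
have wE := walsh_coef_shifted_kernel hb KL2 shifted_kernel_fin_num.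
apply: abs_summing_ext (abs_summing_diag h _) => [k|[k l] /= kl].
  by rewrite in_setT wE eqxx /=.
by rewrite in_setT wE (negbTE kl) /= !mul0r.
Qed.

Lemma mean_sq_wce_walsh (N : nat) (P : N.-tuple V) : (0 < N)%N ->
  (forall x, x \in P -> cub x) ->
  sums_to (index_set b s)
    (fun k => walsh_coef b K (vec_floor b k) (vec_floor b k)
      * (N%:R ^- 2 *
         \sum_(x <- P) \sum_(y <- P) vec_wal b k x * (vec_wal b k y)^*))
    (mean_sq_wce H b P).
Proof.
move=> N0 hP; have [g hg] := integral_representer HK KL2 Kdiag.
rewrite (mean_sq_wceE hb HK KL2 Kdiag shifted_kernel_fin_num hg N0 hP).
apply/sums_toP; set k0 : s.-tuple nat := [tuple 0%N | j < s].
have Nn0 : (N%:R : R[i]) != 0 by rewrite pnatr_eq0 -lt0n.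
have c0 : coef k0 = (`|g| ^+ 2)%:C%C.
  rewrite /coef; case: asboolP => [_|[]]; last first.
    by move=> j; rewrite tnth_mktuple /sum_of_digits big_ord0 dvdn0.
  rewrite (_ : vec_floor b k0 = k0) ?(walsh_coef0E b HK KL2 Kdiag hg)//.
  by apply: eq_from_tnth => j; rewrite !tnth_mktuple div0n.
have S : abs_summing (fun k => N%:R ^- 2 * \sum_(x <- P) \sum_(y <- P)
      coef k * vec_wal b k x * (vec_wal b k y)^*)
    (N%:R ^- 2 * \sum_(x <- P) \sum_(y <- P) (fine (shifted_kernel b K x y))%:C%C).
  apply: abs_summingZ; apply: abs_summing_sum => x /hP cx.
  by apply: abs_summing_sum => y /hP cy; exact: abs_summing_shifted_kernel.
have S0 := abs_summingD S (abs_summingZ (-1) (abs_summing1 k0 (coef k0))).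
have -> : ((N%:R ^- 2 * \sum_(x <- P) \sum_(y <- P) fine (shifted_kernel b K x y) - `|g| ^+ 2)%:C)%C =
   N%:R ^- 2 * \sum_(x <- P) \sum_(y <- P) (fine (shifted_kernel b K x y))%:C%C + -1 * coef k0.
  rewrite c0 mulN1r rmorphB rmorphM fmorphV rmorphXn rmorph_nat; congr (_ * _ - _).
  by rewrite rmorph_sum; apply: eq_bigr => x _; rewrite rmorph_sum.
apply: abs_summing_ext S0 => k.
have fE : N%:R ^- 2 * \sum_(x <- P) \sum_(y <- P) coef k * vec_wal b k x * (vec_wal b k y)^* =
    coef k * (N%:R ^- 2 * \sum_(x <- P) \sum_(y <- P) vec_wal b k x * (vec_wal b k y)^*).
  rewrite mulrCA; congr (_ * _); rewrite mulr_sumr; apply: eq_bigr => x _.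
  by rewrite mulr_sumr; apply: eq_bigr => y _; rewrite mulrA.
(* the term [k = 0] is the squared norm of [g] and cancels *)
rewrite fE; have [->|kk0] := eqVneq k k0.
  rewrite memNset; last by move=> /index_setP[_]; rewrite eqxx.
  rewrite (_ : N%:R ^- 2 * _ = 1) ?mulr1 ?mulN1r ?subrr//.
  rewrite (eq_bigr (fun=> N%:R)) => [|x _].
    rewrite big_const_seq count_predT size_tuple iter_addr_0 -[N%:R *+ N]mulr_natr.
    by rewrite -expr2 mulVf ?expf_neq0.
  rewrite (eq_bigr (fun=> 1)) => [|y _]; last by rewrite !vec_wal0 rmorph1 mulr1.
  by rewrite big_const_seq count_predT size_tuple iter_addr_0.
rewrite mulr0 addr0 /coef; case: asboolP => hk.
  by rewrite mem_set//; exact/index_setP.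
by rewrite memNset ?mul0r// => /index_setP[].
Qed.

End mean_square_error.

Theorem theorem16 (R : realType) (b s : nat) (hb : (2 <= b)%N) (hs : (1 <= s)%N)
    (K : vecR R s -> vecR R s -> R)
    (H : hilbert_fun_space R (cube R s))
    (HK : is_reproducing_kernel H K)
    (Kdiag : (\int[lebn R s]_(x in cube R s) (Num.sqrt (K x x))%:E < +oo)%E)
    (KL2 : square_integrable K)
    (KshL2 : square_integrable (fun x y => fine (shifted_kernel b K x y)))
    (Ksh_walsh : forall x y, cube R s x -> cube R s y ->
      sums_to [set: s.-tuple nat * s.-tuple nat]
        (fun kl =>
          walsh_coef b (fun x y => fine (shifted_kernel b K x y)) kl.1 kl.2
          * vec_wal b kl.1 x * (vec_wal b kl.2 y)^*)
        (shifted_kernel b K x y)) :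
  (forall (N : nat) (P : N.-tuple (vecR R s)), (1 <= N)%N ->
    (forall x, x \in P -> cube R s x) ->
    sums_to (index_set b s)
      (fun k => walsh_coef b K (vec_floor b k) (vec_floor b k)
        * (N%:R ^- 2 *
           \sum_(x <- P) \sum_(y <- P) vec_wal b k x * (vec_wal b k y)^*))
      (mean_sq_wce H b P)) /\
  (forall (m n : nat) (P : (b ^ m).-tuple (vecR R s)), (1 <= m)%N ->
    (m <= n)%N -> digital_net n P ->
    sums_to (index_set b s `&` dual_net n P)
      (fun k => walsh_coef b K (vec_floor b k) (vec_floor b k))
      (mean_sq_wce H b P)).
Proof.
have part1 N (P : N.-tuple (vecR R s)) := @mean_sq_wce_walsh R b s hb K H HK Kdiag KL2 Ksh_walsh N P.
split => [//|m n P m0 mn netP].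
have [uP hP _] := netP.
have bm0 : (0 < b ^ m)%N by rewrite expn_gt0 ltnW.
have cP x : x \in P -> cube R s x.
  by move=> /hP[M ->]; exact: cube_net_point.
have := part1 _ P bm0 cP; have [r [-> _ _]] := part1 _ P bm0 cP.
move=> /sums_toP h; apply/sums_toP; apply: abs_summing_ext h => k.
(* the double sum is the squared modulus of the sum of [wal_k] over the net *)
have -> : \sum_(x <- P) \sum_(y <- P) vec_wal b k x * (vec_wal b k y)^* =
    (\sum_(x <- P) vec_wal b k x) * (\sum_(x <- P) vec_wal b k x)^*.
  rewrite mulr_suml; apply: eq_bigr => x _.
  by rewrite rmorph_sum mulr_sumr.
rewrite (sum_wal_digital_net hb k netP).
have [ki|ki] := pselect (index_set b s k); last first.
  by rewrite !memNset// => -[].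
rewrite (mem_set ki); case: asboolP => hk; last first.
  by rewrite mul0r !mulr0 memNset// => -[].
rewrite mem_set// rmorph_nat -expr2 mulVf ?mulr1// expf_neq0//.
by rewrite pnatr_eq0 -lt0n.
Qed.
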